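(* Let $(M,g)$ be a time-orientable Lorentzian surface with a Spin structure, and let $\psi^+\in\Gamma(S^+)$ and $\psi^-\in\Gamma(S^-)$ be two twistor spinors without zeros. Then $(M,g)$ is conformally flat. In particular, if $M$ is compact, then $(M,g)$ is (geodesically) complete.
   Context: A Lorentzian surface $(M,g)$ is a smooth oriented $2$-manifold with a metric of signature $(1,1)$; in an orthonormal basis $(s_1,s_2)$ the vector $s_1$ is timelike ($g(s_1,s_1)=-1$) and $s_2$ is spacelike. It is time-orientable if it admits a nowhere vanishing timelike vector field. $(M,g)$ is conformally flat if there is a smooth function $\lambda>0$ on $M$ such that $\lambda g$ is flat (globally). The spinor bundle $S=Q\times_{Spin}\Delta_{1,1}$, $\Delta_{1,1}=\mathbb{C}^2$, uses the Clifford representation $e_1\mapsto\begin{pmatrix}0&i\\-i&0\end{pmatrix}$, $e_2\mapsto\begin{pmatrix}0&i\\i&0\end{pmatrix}$ (so $v\cdot v=-g(v,v)$). $S^{+}$ and $S^{-}$ are the eigenbundles of $\omega=s_1\cdot s_2$ (for an oriented orthonormal frame) for the eigenvalues $-1$ and $+1$ respectively. With $\nabla^S$ the spinor connection induced by the Levi-Civita connection, $D\varphi=-s_1\cdot\nabla^S_{s_1}\varphi+s_2\cdot\nabla^S_{s_2}\varphi$. A spinor $\varphi$ is twistor if $\nabla^S_V\varphi=-\tfrac12V\cdot D\varphi$ for all vector fields $V$. *)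

(* Defs.v *)
From HB Require Import structures.
From mathcomp Require Import all_boot all_order all_algebra.
From mathcomp Require Import complex.
From mathcomp Require Import all_classical all_reals all_analysis.

Set Implicit Arguments.
Unset Strict Implicit.
Unset Printing Implicit Defensive.

Import Order.TTheory GRing.Theory Num.Theory numFieldNormedType.Exports.
Local Open Scope classical_set_scope.
Local Open Scope complex_scope.
Local Open Scope ring_scope.

(* Tangent vectors are row vectors of components with
   respect to the coordinate fields of a chart; frames are 2 x 2 matrices whose
   rows are the components of the vectors s_1 and s_2. *)

Section Calculus.
Variable R : realType.
Implicit Types (U : set 'rV[R]_2) (f : 'rV[R]_2 -> R) (x : 'rV[R]_2).

Definition pd (a : 'I_2) f x : R := 'D_(delta_mx 0 a) f x.

(* Meant for open U. *)
Fixpoint Ck (n : nat) U f : Prop :=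
  (forall x, U x -> {for x, continuous f}) /\
  if n is m.+1 then
    forall a : 'I_2,
      (forall x, U x -> derivable f x (delta_mx 0 a)) /\ Ck m U (pd a f)
  else True.

Definition Cinfty U f : Prop := forall n, Ck n U f.

Definition mx2 (K : Type) (a b c d : K) : 'M[K]_2 :=
  \matrix_(i, j) if i == 0 then (if j == 0 then a else b)
                 else (if j == 0 then c else d).

(* Gram matrix of an orthonormal basis: s_1 timelike, s_2 spacelike. *)
Definition eta : 'M[R]_2 := mx2 (-1) 0 0 1.

End Calculus.

Record oriented_surface (R : realType) (M : topologicalType) := OrientedSurface {
  chart : Type;
  dom : chart -> set M;
  crd : chart -> M -> 'rV[R]_2;
  pnt : chart -> 'rV[R]_2 -> M;
  surf_hausdorff : hausdorff_space M;
  surf_countable : @second_countable M;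
  dom_cover : forall p, exists i, dom i p;
  dom_open : forall i, open (dom i);
  img_open : forall i, open (crd i @` dom i);
  crdK : forall i p, dom i p -> pnt i (crd i p) = p;
  crd_cont : forall i p, dom i p -> {for p, continuous (crd i)};
  pnt_cont : forall i x, (crd i @` dom i) x -> {for x, continuous (pnt i)};
  trans_smooth : forall i j (b : 'I_2),
    Cinfty (crd i @` (dom i `&` dom j)) (fun x => crd j (pnt i x) 0 b);
  trans_oriented : forall i j p, dom i p -> dom j p ->
    0 < \det (\matrix_(a < 2, b < 2)
                pd a (fun x => crd j (pnt i x) 0 b) (crd i p))
}.

Section Surface.
Variables (R : realType) (M : topologicalType) (S : oriented_surface R M).
Implicit Types (i j : chart S) (p : M) (U : set M).

(* Components transform by v_j = v_i *m jac i j p. *)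
Definition jac i j p : 'M[R]_2 :=
  \matrix_(a, b) pd a (fun x => crd j (pnt i x) 0 b) (crd i p).

Definition smooth_in i U (f : M -> R) : Prop :=
  Cinfty (crd i @` (dom i `&` U)) (fun x => f (pnt i x)).

Definition smooth_fun (f : M -> R) : Prop := forall i, smooth_in i setT f.

Definition smooth_vector_field (X : chart S -> M -> 'rV[R]_2) : Prop :=
  (forall i j p, dom i p -> dom j p -> X j p = X i p *m jac i j p) /\
  (forall i k, smooth_in i setT (fun p => X i p 0 k)).

Record lorentz_metric := LorentzMetric {
  gm :> chart S -> M -> 'M[R]_2;
  gm_sym : forall i p, dom i p -> (gm i p)^T = gm i p;
  gm_trans : forall i j p, dom i p -> dom j p ->
    gm i p = jac i j p *m gm j p *m (jac i j p)^T;
  gm_smooth : forall i a b, smooth_in i setT (fun p => gm i p a b);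
  gm_signature : forall i p, dom i p ->
    exists B : 'M[R]_2, B *m gm i p *m B^T = eta R
}.

Definition pairing (G : 'M[R]_2) (v w : 'rV[R]_2) : R := (v *m G *m w^T) 0 0.

Section LeviCivita.
(* Components of a symmetric, non-degenerate 2-tensor in every chart. *)
Variable h : chart S -> M -> 'M[R]_2.

Let hloc i (a b : 'I_2) (x : 'rV[R]_2) : R := h i (pnt i x) a b.

Definition christoffel i (k a b : 'I_2) (x : 'rV[R]_2) : R :=
  2^-1 * \sum_(l < 2) invmx (h i (pnt i x)) k l *
    (pd a (hloc i l b) x + pd b (hloc i l a) x - pd l (hloc i a b) x).

(* R^l_{kab} *)
Definition riemann i (l k a b : 'I_2) (x : 'rV[R]_2) : R :=
  pd a (christoffel i l b k) x - pd b (christoffel i l a k) x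
  + \sum_(m < 2) (christoffel i l a m x * christoffel i m b k x
                  - christoffel i l b m x * christoffel i m a k x).

Definition flat : Prop :=
  forall i p, dom i p -> forall l k a b, riemann i l k a b (crd i p) = 0.

(* nabla_v X at the point of coordinates x, for a local vector field X. *)
Definition nabla i (v : 'rV[R]_2) (X : 'rV[R]_2 -> 'rV[R]_2) (x : 'rV[R]_2) :
    'rV[R]_2 :=
  \row_k \sum_(a < 2) v 0 a * (pd a (fun y => X y 0 k) x
                          + \sum_(b < 2) christoffel i k a b x * X x 0 b).

Definition geodesic (c : R -> M) : Prop :=
  continuous c /\
  forall i t, dom i (c t) ->
    let x (k : 'I_2) (s : R) : R := crd i (c s) 0 k in
    forall k, [/\ derivable (x k) t 1, derivable (derive1 (x k)) t 1 &
      derive1 (derive1 (x k)) t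
      + \sum_(a < 2) \sum_(b < 2)
          christoffel i k a b (crd i (c t)) * derive1 (x a) t * derive1 (x b) t
      = 0].

Definition geodesically_complete : Prop :=
  forall i p (v : 'rV[R]_2), dom i p ->
    exists c : R -> M, [/\ geodesic c, c 0 = p &
      forall k, derive1 (fun s => crd i (c s) 0 k) 0 = v 0 k].

End LeviCivita.

Definition time_orientable (g : lorentz_metric) : Prop :=
  exists T : chart S -> M -> 'rV[R]_2, smooth_vector_field T /\
    forall i p, dom i p -> pairing (g i p) (T i p) (T i p) < 0.

Definition conformally_flat (g : lorentz_metric) : Prop :=
  exists lambda : M -> R, [/\ smooth_fun lambda, (forall p, 0 < lambda p) &
    flat (fun i p => lambda p *: g i p)].

End Surface.

Section Clifford.
Variable R : realType.
Local Notation C := R[i].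

Definition cl1 : 'M[C]_2 := mx2 0 (0 +i* 1) (- (0 +i* 1)) 0.
Definition cl2 : 'M[C]_2 := mx2 0 (0 +i* 1) (0 +i* 1) 0.

Definition cliff (x : 'rV[R]_2) : 'M[C]_2 :=
  (x 0 0)%:C *: cl1 + (x 0 1)%:C *: cl2.

Definition mink (x : 'rV[R]_2) : R := pairing (eta R) x x.

(* Spin(1,1), the double cover of SO(1,1), as the group of products of an even
   number of unit vectors; the representation cliff is faithful on the real
   Clifford algebra. *)
Definition spin11 : set 'M[C]_2 := [set A |
  exists s : seq 'rV[R]_2, [/\ ~~ odd (size s),
    (forall x, x \in s -> `|mink x| = 1) &
    A = \big[mulmx/1%:M]_(x <- s) cliff x]].

(* L is the matrix of the image of A in SO(1,1), acting on row vectors: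
   A e_a A^-1 = \sum_b L_ab e_b. *)
Definition spin_covers (A : 'M[C]_2) (L : 'M[R]_2) : Prop :=
  forall x, A *m cliff x = cliff (x *m L) *m A.

End Clifford.

Section Spin.
Variables (R : realType) (M : topologicalType) (S : oriented_surface R M).
Variable g : lorentz_metric S.
Local Notation C := R[i].

(* A section over the open set U of a space Q over M whose points q determine
   frames frm q.  The smooth structure of Q is the one pulled back from the
   bundle of orthonormal frames by the covering map frm. *)
Definition smooth_section_of (Q : topologicalType) (proj : Q -> M)
    (frm : Q -> chart S -> 'M[R]_2) (U : set M) (s : M -> Q) : Prop :=
  [/\ open U, (forall p, U p -> proj (s p) = p),
      (forall p, U p -> {for p, continuous s}) &
      forall i a b, smooth_in i U (fun p => frm (s p) i a b)].

(* A Spin(1,1)-principal bundle Q with right action act, and an equivariant map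
   frm to the SO(1,1)-bundle of oriented orthonormal frames.  C^o is C with its
   usual topology. *)
Record spin_structure := SpinStructure {
  tot :> topologicalType;
  proj : tot -> M;
  act : tot -> 'M[C]_2 -> tot;
  frm : tot -> chart S -> 'M[R]_2;
  proj_cont : continuous proj;
  act1 : forall q, act q 1%:M = q;
  actM : forall q A B, spin11 A -> spin11 B ->
    act (act q A) B = act q (A *m B);
  act_proj : forall q A, spin11 A -> proj (act q A) = proj q;
  act_free : forall q A, spin11 A -> act q A = q -> A = 1%:M;
  frm_trans : forall q i j, dom i (proj q) -> dom j (proj q) ->
    frm q j = frm q i *m jac i j (proj q);
  frm_orthonormal : forall q i, dom i (proj q) ->
    frm q i *m g i (proj q) *m (frm q i)^T = eta R;
  frm_oriented : forall q i, dom i (proj q) -> 0 < \det (frm q i);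
  frm_act : forall q A, spin11 A -> exists2 L, spin_covers A L &
    forall i, dom i (proj q) -> frm (act q A) i = L *m frm q i;
  locally_trivial : forall p, exists (U : set M) (s : M -> tot)
      (d : tot -> 'M[C^o]_2),
    [/\ U p, smooth_section_of proj frm U s,
        (forall q, U (proj q) ->
           spin11 (d q) /\ q = act (s (proj q)) (d q)),
        {within proj @^-1` U, continuous d} &
        {within U `*` (@spin11 R : set 'M[C^o]_2),
          continuous (fun z : M * 'M[C^o]_2 => act (s z.1) z.2)}]
}.

Variable Q : spin_structure.

Definition smooth_section (U : set M) (s : M -> Q) : Prop :=
  smooth_section_of (@proj Q) (@frm Q) U s.

(* Sections of the spinor bundle Q x_Spin C^2, as equivariant functions on Q:
   the value at p is the class of (q, psi q) for any q over p. *)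
Definition spinor_field (psi : Q -> 'cV[C]_2) : Prop :=
  (forall q A, spin11 A -> psi (act q A) = invmx A *m psi q) /\
  (forall U s, smooth_section U s -> forall (i : chart S) (k : 'I_2),
     smooth_in i U (fun p => complex.Re (psi (s p) k 0)) /\
     smooth_in i U (fun p => complex.Im (psi (s p) k 0))).

Definition section_Splus (psi : Q -> 'cV[C]_2) : Prop :=
  spinor_field psi /\ forall q, cl1 R *m cl2 R *m psi q = - psi q.

Definition section_Sminus (psi : Q -> 'cV[C]_2) : Prop :=
  spinor_field psi /\ forall q, cl1 R *m cl2 R *m psi q = psi q.

Definition nowhere_zero (psi : Q -> 'cV[C]_2) : Prop := forall q, psi q != 0.

Definition pdC (a : 'I_2) (f : 'rV[R]_2 -> C) (x : 'rV[R]_2) : C :=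
  pd a (fun y => complex.Re (f y)) x +i* pd a (fun y => complex.Im (f y)) x.

(* Spinor connection in the local section s with frame (s_1, s_2):
     V(psi) + 1/2 \sum_(k < l) eps_k eps_l g(nabla_V s_k, s_l) e_k e_l psi,
   where eps_1 eps_2 = -1. *)
Definition nablaS (psi : Q -> 'cV[C]_2) (s : M -> Q) (i : chart S)
    (v : 'rV[R]_2) (p : M) : 'cV[C]_2 :=
  let x := crd i p in
  let s1 y := row 0 (frm (s (pnt i y)) i) in
  (\col_k \sum_(a < 2) (v 0 a)%:C * pdC a (fun y => psi (s (pnt i y)) k 0) x)
  - (2^-1 * pairing (g i p) (nabla g i v s1 x) (row 1 (frm (s p) i)))%:C
      *: (cl1 R *m cl2 R *m psi (s p)).

Definition dirac (psi : Q -> 'cV[C]_2) (s : M -> Q) (i : chart S) (p : M) :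
    'cV[C]_2 :=
  - (cl1 R *m nablaS psi s i (row 0 (frm (s p) i)) p)
  + cl2 R *m nablaS psi s i (row 1 (frm (s p) i)) p.

(* The tangent vector V at p is v_1 s_1 + v_2 s_2. *)
Definition twistor (psi : Q -> 'cV[C]_2) : Prop :=
  forall U s, smooth_section U s -> forall (i : chart S) p, U p -> dom i p ->
  forall v : 'rV[R]_2,
    nablaS psi s i (v *m frm (s p) i) p
    = - (2^-1 *: (cliff v *m dirac psi s i p)).

End Spin.

(* Main.v *)
(** The spinors have the form psi^+ = (a, 0) and psi^- = (0, b).  In an oriented
    orthonormal frame the twistor equation says that nabla_(s_1 - s_2) a = 0 and
    nabla_(s_1 + s_2) b = 0.  Hence, up to a common sign fixed by the time
    orientation, V_0 = |a|^2 (s_1 + s_2) and V_1 = |b|^2 (s_1 - s_2) are globally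
    defined commuting null fields with g(V_0, V_1) = - 2 mu, mu = |a|^2 |b|^2.
    For the metric g / mu both fields are parallel, so that g / mu is flat.

    For completeness, write the velocity of a geodesic as a_0 V_0 + a_1 V_1.
    The energy e = a_0 a_1 mu is constant and (a_m mu)' = e V_(1-m)(log mu), which
    is bounded on a compact surface.  Thus the velocity stays bounded on bounded
    intervals, where local solutions live for a uniform time, and geodesics
    extend indefinitely. *)
Require Import Defs.
From mathcomp Require Import all_boot all_order all_algebra.
From mathcomp Require Import complex ring lra.
From mathcomp Require Import all_classical all_reals all_analysis.

Set Implicit Arguments.
Unset Strict Implicit.
Unset Printing Implicit Defensive.

Import Order.TTheory GRing.Theory Num.Theory numFieldNormedType.Exports.
Local Open Scope classical_set_scope.
Local Open Scope complex_scope.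
Local Open Scope ring_scope.

(** * Calculus in the plane *)

Lemma ord2P (i : 'I_2) : i = 0 \/ i = 1.
Proof. by case: i => [[|[|m]] h] //; [left|right]; apply: val_inj. Qed.

Lemma sum2E (V : zmodType) (f : 'I_2 -> V) : \sum_(a < 2) f a = f 0 + f 1.
Proof.
rewrite big_ord_recl big_ord_recl big_ord0 addr0.
by congr (_ + f _); apply: val_inj.
Qed.

Lemma lt_half_contra (R : realFieldType) (a b c : R) :
  c <= a + b -> a < c / 2 -> b < c / 2 -> False.
Proof. lra. Qed.

Section PartialDerivatives.
Variable R : realType.
Implicit Types (W : set 'rV[R]_2) (f g : 'rV[R]_2 -> R) (x y z : 'rV[R]_2).

Local Notation e_ a := (delta_mx 0 a : 'rV[R]_2).

Lemma rV2P x y : x 0 0 = y 0 0 -> x 0 1 = y 0 1 -> x = y.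
Proof.
move=> h0 h1; apply/rowP => i.
by case: (ord2P i) => ->.
Qed.

Definition box z (r : R) : set 'rV[R]_2 :=
  [set x | forall a, `|x 0 a - z 0 a| < r].

Lemma nbhs_box z (A : set 'rV[R]_2) :
  nbhs z A <-> exists2 r, 0 < r & box z r `<=` A.
Proof.
split=> [/nbhs_ballP[r/= r0 rA]|[r r0 rA]].
  exists r => // x bx; apply: rA; split=> // i a.
  by rewrite (ord1 i) /ball/= distrC; have := bx a.
apply/nbhs_ballP; exists r => //= x [_ bx]; apply: rA => a.
by have := bx 0 a; rewrite /ball/= distrC.
Qed.

Lemma box_center z r : 0 < r -> box z r z.
Proof. by move=> r0 a; rewrite subrr normr0. Qed.

Lemma cvg_rV2 (T : Type) (F : set_system T) (FF : Filter F)
    (c : T -> 'rV[R]_2) x :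
  (forall k, (fun t => c t 0 k) @ F --> x 0 k) -> c @ F --> x.
Proof.
move=> ck A /nbhs_box[r r0 rA]; rewrite /nbhs/=.
have h k : \forall t \near F, `|c t 0 k - x 0 k| < r.
  by have /cvgrPdist_lt/(_ _ r0) := ck k; apply: filterS => t; rewrite distrC.
apply: (@filterS _ F _ _ _ _ (filterI (h 0) (h 1))) => t [h0 h1]; apply: rA => a.
by case: (ord2P a) => ->.
Qed.

Lemma is_derive_line f x v (h : R) : derivable f (h *: v + x) v ->
  is_derive h 1 (fun t => f (t *: v + x)) ('D_v f (h *: v + x)).
Proof.
move=> df.
have E : (fun k : R => k^-1 *: (((fun t => f (t *: v + x)) \o shift h) (k *: 1)
    - f (h *: v + x))) =
  (fun k : R => k^-1 *: ((f \o shift (h *: v + x)) (k *: v) - f (h *: v + x))).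
  apply/funext => k /=; congr (_ *: (f _ - _)).
  by rewrite [k *: 1]mulr1 scalerDl addrA.
by split; rewrite /derivable /derive E.
Qed.

Lemma is_derive_comp1 (f k : R -> R) (t df dk : R) :
  is_derive (k t) 1 f df -> is_derive t 1 k dk ->
  is_derive t 1 (fun s => f (k s)) (dk * df).
Proof.
move=> [f1 f2] [k1 k2]; rewrite -[fun s => _]/(f \o k); split.
  apply/derivable1_diffP/differentiable_comp; first exact/derivable1_diffP.
  by apply/derivable1_diffP; exact: f1.
by rewrite -derive1E (derive1_comp k1 f1) !derive1E f2 k2 mulrC.
Qed.

Lemma mvt_real (phi dphi : R -> R) (h : R) :
  (forall th : R, 0 <= th <= 1 -> is_derive (th * h) 1 phi (dphi (th * h))) ->
  exists2 th : R, 0 <= th <= 1 & phi h - phi 0 = h * dphi (th * h).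
Proof.
move=> dp.
pose psi t := phi (t * h).
have dpsi (t : R) : 0 <= t <= 1 -> is_derive t 1 psi (h * dphi (t * h)).
  move=> /dp d1.
  have d2 : is_derive t 1 ( *%R^~ h : R -> R) h.
    have := @is_deriveM _ _ id (cst h) t 1 1 0 _ _.
    by move=> H; apply: is_derive_eq; rewrite /= scaler0 add0r [_ *: _]mulr1.
  exact: (@is_derive_comp1 _ ( *%R^~ h) t _ _ d1 d2).
have [||c] := @MVT_segment R psi (fun t => h * dphi (t * h)) 0 1 ler01.
- by move=> c; rewrite in_itv /= => /andP[/ltW c0 /ltW c1]; apply: dpsi; rewrite c0.
- apply: continuous_in_subspaceT => c; rewrite inE /= in_itv /= => cI.
  apply: differentiable_continuous; apply/derivable1_diffP.
  by have [] := dpsi _ cI.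
by rewrite in_itv /= => c01; rewrite /psi mul1r mul0r subr0 mulr1 => ->; exists c.
Qed.

Lemma mvt_line f x v (h : R) :
  (forall th : R, 0 <= th <= 1 -> derivable f ((th * h) *: v + x) v) ->
  exists2 th : R, 0 <= th <= 1 &
    f (h *: v + x) - f x = h * 'D_v f ((th * h) *: v + x).
Proof.
move=> df.
have [|th th01 E] := @mvt_real (fun t => f (t *: v + x))
  (fun t => 'D_v f (t *: v + x)) h.
  by move=> th /df; apply: is_derive_line.
by exists th => //; rewrite -E scale0r add0r.
Qed.

Lemma axisE x (h : R) a k : (h *: e_ a + x) 0 k = h * (k == a)%:R + x 0 k.
Proof. by rewrite !mxE eqxx. Qed.

Lemma box_increment f z r x y :
  (forall u, box z r u -> forall a, derivable f u (e_ a)) ->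
  box z r x -> box z r y ->
  exists xi : 'I_2 -> 'rV[R]_2,
    [/\ forall a, box z r (xi a),
        forall a k, `|xi a 0 k - x 0 k| <= `|y 0 k - x 0 k| &
        f y - f x = \sum_(a < 2) (y 0 a - x 0 a) * pd a f (xi a)].
Proof.
move=> df bx byy.
pose h (a : 'I_2) := y 0 a - x 0 a.
pose x' := h 0 *: e_ 0 + x.
have yE : y = h 1 *: e_ 1 + x'.
  by apply: rV2P; rewrite !axisE /= /h; ring.
have conv (th : R) a : 0 <= th <= 1 -> `|th * h a + x 0 a - z 0 a| < r.
  move=> /andP[t0 t1].
  have -> : th * h a + x 0 a - z 0 a =
    th * (y 0 a - z 0 a) + (1 - th) * (x 0 a - z 0 a) by rewrite /h; ring.
  apply: le_lt_trans (ler_normD _ _) _.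
  rewrite !normrM (ger0_norm t0) (@ger0_norm _ (1 - th)) ?subr_ge0//.
  move: (byy a) (bx a); move: (`|y 0 a - _|) (`|x 0 a - _|) => p q pr qr.
  have [->|t] := eqVneq th 0; first by rewrite mul0r subr0 mul1r add0r.
  have tp : 0 < th by rewrite lt_neqAle eq_sym t.
  have : th * p < th * r by rewrite ltr_pM2l.
  have : (1 - th) * q <= (1 - th) * r by rewrite ler_wpM2l ?subr_ge0// ltW.
  lra.
have b0 (th : R) : 0 <= th <= 1 -> box z r ((th * h 0) *: e_ 0 + x).
  move=> t01 a; rewrite axisE; case: (ord2P a) => -> /=.
    by rewrite mulr1; exact: conv.
  by rewrite mulr0 add0r; exact: bx.
have b1 (th : R) : 0 <= th <= 1 -> box z r ((th * h 1) *: e_ 1 + x').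
  move=> t01 a; rewrite axisE; case: (ord2P a) => -> /=; rewrite axisE /=.
    by rewrite mulr0 add0r mulr1 -[h 0]mul1r; apply: conv; rewrite ler01 lexx.
  by rewrite mulr1 mulr0 add0r; exact: conv.
have [t0 t001 E0] := @mvt_line f x (e_ 0) (h 0) (fun th t01 => df _ (b0 _ t01) 0).
have [t1 t101 E1] := @mvt_line f x' (e_ 1) (h 1) (fun th t01 => df _ (b1 _ t01) 1).
exists (fun a => if a == 0 then (t0 * h 0) *: e_ 0 + x
                 else (t1 * h 1) *: e_ 1 + x'); split.
- by move=> a; case: (ord2P a) => -> /=; [exact: b0|exact: b1].
- have P (th : R) a : 0 <= th <= 1 -> `|th * h a| <= `|h a|.
    move=> /andP[p0 p1]; rewrite normrM ger0_norm//.
    by rewrite ler_piMl.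
  move=> a k; case: (ord2P a) => -> /=; case: (ord2P k) => -> /=;
    rewrite !axisE /= ?mulr0 ?mulr1 ?add0r ?subrr ?normr0 ?addrK ?P//.
- rewrite sum2E /= -/(h 0) -/(h 1) /pd -E0 -E1 -yE -/x'; ring.
Qed.

Lemma chain_rule W f (c : R -> 'rV[R]_2) t (d : 'I_2 -> R) :
  open W -> Ck 1 W f -> W (c t) ->
  (forall k, is_derive t 1 (fun s => c s 0 k) (d k)) ->
  is_derive t 1 (fun s => f (c s)) (\sum_(a < 2) d a * pd a f (c t)).
Proof.
move=> oW [_ C1] Wc dc.
have /nbhs_box[r r0 rW] : nbhs (c t) W by exact: open_nbhs_nbhs.
have df u : box (c t) r u -> forall a, derivable f u (e_ a).
  by move=> /rW Wu a; exact: (C1 a).1.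
have ct : {for t, continuous c}.
  apply: cvg_rV2 => k; have [+ _] := dc k.
  by move=> /derivable1_diffP/differentiable_continuous.
have nb : \forall s \near t, box (c t) r (c s).
  by apply: ct; apply/nbhs_box; exists r.
have [xi xiP] := @choice _ _ (fun s (xi : 'I_2 -> 'rV[R]_2) =>
  box (c t) r (c s) -> (forall a k, `|xi a 0 k - c t 0 k| <= `|c s 0 k - c t 0 k|)
    /\ f (c s) - f (c t) = \sum_(a < 2) (c s 0 a - c t 0 a) * pd a f (xi a))
  ltac:(by move=> s; have [b|b] := pselect (box (c t) r (c s));
    [have [xi [_ h1 h2]] := box_increment df (box_center _ r0) b; exists xi
    | exists (fun=> 0)]).
have xic a : xi s a @[s --> t] --> c t.
  apply: cvg_rV2 => k; apply/cvgrPdist_lt => e e0.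
  have /cvgrPdist_lt/(_ _ e0) : (fun s => c s 0 k) @ t --> c t 0 k.
    have [+ _] := dc k.
    by move=> /derivable1_diffP/differentiable_continuous.
  apply: filterS2 nb => s /xiP[+ _] => /(_ a k).
  by rewrite distrC => /le_lt_trans h; rewrite distrC => /h.
have lim : (fun h => h^-1 *: (((fun s => f (c s)) \o shift t) (h *: (1 : R))
   - f (c t))) @ 0^' --> \sum_(a < 2) d a * pd a f (c t).
  have sh : (fun h : R => h + t) @ 0^' --> t.
    have : (fun h : R => h + t) @ 0 --> 0 + t by apply: cvgD; [exact: cvg_id|exact: cvg_cst].
    rewrite add0r; apply: cvg_trans; apply: cvg_app; exact: nbhs_dnbhs.
  have L : (fun h : R => \sum_(a < 2) (h^-1 *: (c (h + t) 0 a - c t 0 a)) *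
      pd a f (xi (h + t) a)) @ 0^' --> \sum_(a < 2) d a * pd a f (c t).
    rewrite sum2E; under eq_fun do rewrite sum2E.
    apply: cvgD; apply: cvgM.
    - have [dd <-] := dc 0; have := dd; rewrite /derivable/= /derive/=.
      by under eq_fun do rewrite [_ *: 1]mulr1.
    - have := cvg_comp _ _ sh (xic 0).
      by move/cvg_comp; apply; have [+ _] := (C1 0).2; apply.
    - have [dd <-] := dc 1; have := dd; rewrite /derivable/= /derive/=.
      by under eq_fun do rewrite [_ *: 1]mulr1.
    - have := cvg_comp _ _ sh (xic 1).
      by move/cvg_comp; apply; have [+ _] := (C1 1).2; apply.
  apply: cvg_trans L; apply: near_eq_cvg.
  have := sh _ nb; rewrite /= => nb'; near=> h.
  rewrite /= [h *: 1]mulr1.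
  have [|_ ->] := xiP (h + t); first by near: h.
  by rewrite scaler_sumr; apply: eq_bigr => a _; rewrite -scalerAl.
split; first by apply/cvg_ex; eexists; exact: lim.
by apply/cvg_lim => //; exact: lim.
Unshelve. all: by end_near. Qed.

Lemma Ck_continuous n W f x : Ck n W f -> W x -> {for x, continuous f}.
Proof. by case: n => [|n] [+ _]; apply. Qed.

Lemma Ck_derivable n W f x a : Ck n.+1 W f -> W x -> derivable f x (e_ a).
Proof. by move=> [_ /(_ a)[+ _]]; apply. Qed.

Lemma CkS n W f : Ck n.+1 W f -> Ck n W f.
Proof.
elim: n f => [|n IH] f; first by move=> [].
move=> [cf H]; split=> // a; have [da Ca] := H a; split=> //.
exact: IH.
Qed.

Lemma Ck_pd n W f a : Ck n.+1 W f -> Ck n W (pd a f).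
Proof. by move=> [_ /(_ a)[]]. Qed.

Lemma schwarz W f x : open W -> Ck 2 W f -> W x ->
  pd 0 (pd 1 f) x = pd 1 (pd 0 f) x.
Proof.
move=> oW C2 Wx.
have /nbhs_box[r r0 rW] : nbhs x W by exact: open_nbhs_nbhs.
have key (a b : 'I_2) (h : R) : a != b -> 0 < h < r -> exists2 xi, box x r xi /\
    (forall k, `|xi 0 k - x 0 k| <= h) &
    f (h *: e_ a + (h *: e_ b + x)) - f (h *: e_ a + x)
     - (f (h *: e_ b + x) - f x) = h * (h * pd b (pd a f) xi).
  move=> ab /andP[h0 hr].
  have thP (th : R) : 0 <= th <= 1 -> `|th * h| <= h.
    move=> /andP[t0 t1]; rewrite normrM (ger0_norm t0) (gtr0_norm h0).
    by rewrite ler_piMl// ltW.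
  have bx (p q : R) : `|p| <= h -> `|q| <= h -> forall k,
      `|(p *: e_ a + (q *: e_ b + x)) 0 k - x 0 k| <= h.
    move=> ph qh k; rewrite !axisE.
    have -> : p * (k == a)%:R + (q * (k == b)%:R + x 0 k) - x 0 k =
      p * (k == a)%:R + q * (k == b)%:R by ring.
    have [->|] := eqVneq k a; first by rewrite (negbTE ab) mulr1 mulr0 addr0.
    by rewrite mulr0 add0r => _; case: eqP; rewrite ?mulr1 ?mulr0 ?normr0// ltW.
  have bxr (p q : R) : `|p| <= h -> `|q| <= h ->
      box x r (p *: e_ a + (q *: e_ b + x)).
    by move=> ph qh k; apply: le_lt_trans hr; exact: bx.
  have h1 : `|h| <= h by rewrite gtr0_norm.
  have h00 : `|0 : R| <= h by rewrite normr0 ltW.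
  pose G u := f (h *: e_ b + u) - f u.
  have [th t01 E1] : exists2 th : R, 0 <= th <= 1 & G (h *: e_ a + x) - G x = h *
     (pd a f ((th * h) *: e_ a + (h *: e_ b + x))
      - pd a f ((th * h) *: e_ a + (0 *: e_ b + x))).
    have D (th : R) : 0 <= th <= 1 -> is_derive ((th * h) *: e_ a + x) (e_ a) G
       (pd a f ((th * h) *: e_ a + (h *: e_ b + x))
      - pd a f ((th * h) *: e_ a + (0 *: e_ b + x))).
      move=> t01; apply: is_deriveB; last first.
        rewrite scale0r add0r; apply/derivableP; apply: Ck_derivable C2 _.
        apply: rW; have := bxr (th * h) 0; rewrite scale0r add0r; apply => //.
        exact: thP.
      have sE u : h *: e_ b + ((th * h) *: e_ a + u) =
         (th * h) *: e_ a + (h *: e_ b + u) by rewrite addrCA.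
      have dd : derivable f ((th * h) *: e_ a + (h *: e_ b + x)) (e_ a).
        by apply: Ck_derivable C2 _; apply: rW; apply: bxr => //; exact: thP.
      suff E : (fun k : R => k^-1 *: (((fun u => f (h *: e_ b + u)) \o
          shift ((th * h) *: e_ a + x)) (k *: e_ a)
          - f (h *: e_ b + ((th * h) *: e_ a + x)))) =
        (fun k : R => k^-1 *: ((f \o shift ((th * h) *: e_ a + (h *: e_ b + x)))
          (k *: e_ a) - f ((th * h) *: e_ a + (h *: e_ b + x)))).
        by split; rewrite /pd /derivable /derive E.
      apply/funext => k /=; rewrite sE; congr (_ *: (f _ - _)).
      by rewrite addrCA sE.
    have [|th t01 ->] := @mvt_line G x (e_ a) h.
      by move=> th /D[].
    by exists th => //; have [_ ->] := D th t01.
  have {}E1 : f (h *: e_ a + (h *: e_ b + x)) - f (h *: e_ a + x)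
     - (f (h *: e_ b + x) - f x) = h *
     (pd a f ((th * h) *: e_ a + (h *: e_ b + x))
      - pd a f ((th * h) *: e_ a + (0 *: e_ b + x))).
    by rewrite -E1 /G addrCA.
  have C1 := Ck_pd a C2.
  have [|th' t01' E2] := @mvt_line (pd a f) ((th * h) *: e_ a + x) (e_ b) h.
    move=> t t01'; apply: Ck_derivable C1 _; apply: rW; rewrite addrCA.
    by apply: bxr; exact: thP.
  exists ((th * h) *: e_ a + ((th' * h) *: e_ b + x)).
    by split; [apply: bxr; exact: thP|apply: bx; exact: thP].
  by rewrite E1 scale0r add0r -[_ *: e_ a + (_ *: e_ b + x)]addrCA E2 addrCA.
apply/eqP; rewrite -subr_eq0; apply/eqP.
apply: contrapT => /eqP; rewrite -normr_gt0 => ep.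
set e := `|_| in ep.
have [c1 c2] : {for x, continuous (pd 0 (pd 1 f))} /\
               {for x, continuous (pd 1 (pd 0 f))}.
  by split; apply: (@Ck_continuous 0 W) => //; do 2 apply: Ck_pd.
have e2 : 0 < e / 2 by rewrite divr_gt0.
have /cvgrPdist_lt/(_ _ e2)/nbhs_box[r1 r10 H1] := c1.
have /cvgrPdist_lt/(_ _ e2)/nbhs_box[r2 r20 H2] := c2.
pose h := Num.min r (Num.min r1 r2) / 2.
have m0 : 0 < Num.min r (Num.min r1 r2) by rewrite !lt_min r0 r10 r20.
have hm : h < Num.min r (Num.min r1 r2) by rewrite /h ltr_pdivrMr// ltr_pMr// ltr1n.
have h0 : 0 < h by rewrite divr_gt0.
move: (hm); rewrite !lt_min => /and3P[hr hr1 hr2].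
have [||xi [_ bxi] E] := key 0 1 h => //; first by rewrite h0.
have [||xi' [_ bxi'] E'] := key 1 0 h => //; first by rewrite h0.
have : pd 1 (pd 0 f) xi = pd 0 (pd 1 f) xi'.
  have hn : h != 0 by rewrite gt_eqF.
  move: E E'; rewrite [h *: e_ 0 + (h *: e_ 1 + x)]addrCA.
  move: (pd 1 (pd 0 f) xi) (pd 0 (pd 1 f) xi') (f (_ + _)) (f (_ + _)) (f (_ + _)) (f x).
  move=> p q u1 u2 u3 u4 E E'.
  by apply: (mulfI hn); apply: (mulfI hn); rewrite -E -E'; ring.
have := H2 xi (fun k => le_lt_trans (bxi k) hr2).
have := H1 xi' (fun k => le_lt_trans (bxi' k) hr1).
rewrite /= => A B AB; move: A B; rewrite AB.
move: (pd 0 (pd 1 f) xi') => q; rewrite /e.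
move: (pd 0 (pd 1 f) x) (pd 1 (pd 0 f) x) => u v.
have : `|u - v| <= `|u - q| + `|v - q|.
  by rewrite [X in _ <= _ + X]distrC -[u - v](subrKA q); exact: ler_normD.
exact: lt_half_contra.
Qed.

End PartialDerivatives.

Section CkAlgebra.
Variable R : realType.
Implicit Types (W : set 'rV[R]_2) (f g : 'rV[R]_2 -> R) (x y z : 'rV[R]_2).

Local Notation e_ a := (delta_mx 0 a : 'rV[R]_2).

Lemma open_near W x (P : 'rV[R]_2 -> Prop) :
  open W -> W x -> (forall y, W y -> P y) -> \forall y \near x, P y.
Proof.
move=> oW Wx WP.
by apply: (@filterS _ _ _ W) => //; exact: open_nbhs_nbhs.
Qed.

Lemma pd_near f g x a : (\forall y \near x, f y = g y) -> pd a f x = pd a g x.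
Proof. exact: near_eq_derive. Qed.

Lemma pd_ext W f g x a :
  open W -> (forall y, W y -> f y = g y) -> W x -> pd a f x = pd a g x.
Proof. by move=> oW fg Wx; apply: pd_near; exact: open_near fg. Qed.

Lemma pdM f g x a : derivable f x (e_ a) -> derivable g x (e_ a) ->
  pd a (fun u => f u * g u) x = pd a f x * g x + f x * pd a g x.
Proof.
move=> df dg; rewrite /pd (deriveM df dg) addrC.
by congr (_ + _); rewrite [LHS]mulrC.
Qed.

Lemma pdD f g x a : derivable f x (e_ a) -> derivable g x (e_ a) ->
  pd a (fun u => f u + g u) x = pd a f x + pd a g x.
Proof. by move=> df dg; rewrite /pd (deriveD df dg). Qed.

Lemma pdV f x a : f x != 0 -> derivable f x (e_ a) ->
  pd a (fun u => (f u)^-1) x = - pd a f x / (f x ^+ 2).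
Proof. by move=> f0 df; rewrite /pd (deriveV f0 df) -[_ *: _]/(_ * _) !mulNr mulrC. Qed.

Lemma pd_cst (k : R) x a : pd a (fun=> k) x = 0.
Proof. exact: derive_cst. Qed.

Lemma pdZ (k : R) f x a : derivable f x (e_ a) ->
  pd a (fun u => k * f u) x = k * pd a f x.
Proof.
by move=> df; rewrite (pdM (derivable_cst _ _ _) df) pd_cst mul0r add0r.
Qed.

Lemma Ck_ext n W f g :
  open W -> (forall x, W x -> f x = g x) -> Ck n W f -> Ck n W g.
Proof.
move=> oW.
have ce (h k : 'rV[R]_2 -> R) x : (forall y, W y -> h y = k y) -> W x ->
    {for x, continuous h} -> {for x, continuous k}.
  move=> hk Wx; rewrite /prop_for /continuous_at -(hk _ Wx); apply: cvg_trans.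
  exact: near_eq_cvg (open_near oW Wx hk).
elim: n f g => [|n IH] f g fg /= [cf H]; (split=> [x Wx|//]).
- by apply: ce (cf _ Wx).
- by apply: ce (cf _ Wx).
move=> a; have [df Cf] := H a; split=> [x Wx|].
  have E : \forall y \near x, f y = g y by exact: open_near fg.
  exact: near_eq_derivable (df _ Wx).
by apply: IH Cf => x Wx; exact: pd_ext Wx.
Qed.

Lemma Ck_sub n W W' f : W' `<=` W -> Ck n W f -> Ck n W' f.
Proof.
move=> sW; elim: n f => [|n IH] f /= [cf H]; (split=> [x /sW Wx|//]).
- exact: cf.
- exact: cf.
by move=> a; have [df Cf] := H a; split=> [x /sW|]; [exact: df|exact: IH].
Qed.

Lemma Ck_local n W f :
  (forall x, W x -> exists2 W', W' x & Ck n W' f) -> Ck n W f.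
Proof.
elim: n f => [|n IH] f H /=; (split=> [x Wx|//]).
- by have [W' W'x C] := H x Wx; exact: Ck_continuous C _.
- by have [W' W'x C] := H x Wx; exact: Ck_continuous C _.
move=> a; split=> [x Wx|].
  by have [W' W'x C] := H x Wx; exact: Ck_derivable C _.
by apply: IH => x /H[W' W'x C]; exists W' => //; exact: Ck_pd.
Qed.

Lemma Ck_cst n W (k : R) : open W -> Ck n W (fun=> k).
Proof.
move=> oW; elim: n k => [|n IH] k /=; (split=> [x _|//]); try exact: cst_continuous.
move=> a; split=> [x _|]; first exact: derivable_cst.
by apply: Ck_ext (IH 0) => // x _; rewrite pd_cst.
Qed.

Lemma CkD n W f g : open W -> Ck n W f -> Ck n W g ->
  Ck n W (fun x => f x + g x).
Proof.
move=> oW; elim: n f g => [|n IH] f g Cf Cg; (split=> [x Wx|//]).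
- exact: (continuousD (Ck_continuous Cf Wx) (Ck_continuous Cg Wx)).
- exact: (continuousD (Ck_continuous Cf Wx) (Ck_continuous Cg Wx)).
move=> a; split=> [x Wx|].
  exact: (derivableD (Ck_derivable Cf Wx) (Ck_derivable Cg Wx)).
apply: (@Ck_ext _ _ (fun x => pd a f x + pd a g x)) => // [x Wx|].
  by rewrite (pdD (Ck_derivable Cf Wx) (Ck_derivable Cg Wx)).
by apply: IH; exact: Ck_pd.
Qed.

Lemma CkM n W f g : open W -> Ck n W f -> Ck n W g ->
  Ck n W (fun x => f x * g x).
Proof.
move=> oW; elim: n f g => [|n IH] f g Cf Cg; (split=> [x Wx|//]).
- exact: (continuousM (Ck_continuous Cf Wx) (Ck_continuous Cg Wx)).
- exact: (continuousM (Ck_continuous Cf Wx) (Ck_continuous Cg Wx)).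
move=> a; split=> [x Wx|].
  exact: (derivableM (Ck_derivable Cf Wx) (Ck_derivable Cg Wx)).
apply: (@Ck_ext _ _ (fun x => pd a f x * g x + f x * pd a g x)) => // [x Wx|].
  by rewrite (pdM (Ck_derivable Cf Wx) (Ck_derivable Cg Wx)).
by apply: CkD => //; apply: IH; (exact: Ck_pd || exact: CkS).
Qed.

Lemma CkV n W f : open W -> (forall x, W x -> f x != 0) -> Ck n W f ->
  Ck n W (fun x => (f x)^-1).
Proof.
move=> oW f0; elim: n => [|n IH] Cf; (split=> [x Wx|//]).
- exact: (continuousV (f0 _ Wx) (Ck_continuous Cf Wx)).
- exact: (continuousV (f0 _ Wx) (Ck_continuous Cf Wx)).
move=> a; split=> [x Wx|].
  exact: (derivableV (f0 _ Wx) (Ck_derivable Cf Wx)).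
pose h x := (-1 * pd a f x) * ((f x)^-1 * (f x)^-1).
apply: (@Ck_ext _ _ h) => // [x Wx|].
  rewrite (pdV (f0 _ Wx) (Ck_derivable Cf Wx)).
  by rewrite /h mulN1r expr2 invfM.
have {}IH := IH (CkS Cf).
by apply: CkM => //; apply: CkM => //; [exact: Ck_cst|exact: Ck_pd].
Qed.

Lemma CkN n W f : open W -> Ck n W f -> Ck n W (fun x => - f x).
Proof.
move=> oW Cf; apply: (@Ck_ext _ _ (fun x => -1 * f x)) => // [x _|].
  by rewrite mulN1r.
by apply: CkM => //; exact: Ck_cst.
Qed.

Lemma C1_lipschitz W f z : open W -> Ck 1 W f -> W z ->
  exists r L B : R, [/\ 0 < r, 0 <= L, box z r `<=` W,
    forall x, box z r x -> `|f x| <= B &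
    forall x y d, box z r x -> box z r y -> (forall a, `|x 0 a - y 0 a| <= d) ->
      `|f x - f y| <= L * d].
Proof.
move=> oW C1 Wz.
have /nbhs_box[r0 r00 r0W] : nbhs z W by exact: open_nbhs_nbhs.
have bd g : {for z, continuous g} ->
    exists2 r : R, 0 < r & forall x, box z r x -> `|g x| <= `|g z| + 1.
  move=> /cvgrPdist_lt/(_ _ ltr01)/nbhs_box[r rp H]; exists r => // x /H /ltW h.
  rewrite -[g x](subrKC (g z)) (le_trans (ler_normD _ _))// lerD2l.
  by rewrite distrC.
have [r1 r10 H1] := bd _ (Ck_continuous C1 Wz).
have [r2 r20 H2] := bd _ (Ck_continuous (Ck_pd 0 C1) Wz).
have [r3 r30 H3] := bd _ (Ck_continuous (Ck_pd 1 C1) Wz).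
pose r := Num.min (Num.min r0 r1) (Num.min r2 r3).
have sb s : r <= s -> box z r `<=` box z s.
  by move=> rs x bx a; exact: lt_le_trans (bx a) rs.
have [b0 b1 b2 b3] : [/\ r <= r0, r <= r1, r <= r2 & r <= r3].
  by rewrite /r; split; rewrite !ge_min lexx ?orbT.
pose L := (`|pd 0 f z| + 1) + (`|pd 1 f z| + 1).
exists r, L, (`|f z| + 1); split.
- by rewrite /r !lt_min r00 r10 r20 r30.
- by rewrite /L !addr_ge0.
- exact: subset_trans (sb _ b0) r0W.
- by move=> x bx; apply: H1; exact: sb bx.
move=> x y d bx byy xy.
have [u bu a|xi [bxi _ ->]] := @box_increment _ f z r y x _ byy bx.
  by apply: Ck_derivable C1 _; apply: r0W; exact: sb bu.
rewrite sum2E (le_trans (ler_normD _ _))// /L [leRHS]mulrDl.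
rewrite !normrM lerD//; rewrite mulrC ler_pM//.
  by apply: H2; exact: (sb _ b2).
by apply: H3; exact: (sb _ b3).
Qed.

End CkAlgebra.

(** * The Picard-Lindelof theorem *)

Section Ode.
Variable R : realType.

Lemma primitive_exists (f : R -> R) (b : R) : 0 < b -> continuous f ->
  exists G : R -> R, G 0 = 0 /\ forall t : R, `|t| < b -> is_derive t 1 G (f t).
Proof.
move=> b0 cf.
pose H (x : R) := (\int[lebesgue_measure]_(t in [set` `[- b, x]]) (f t))%R.
exists (fun x => H x - H 0); split; first by rewrite subrr.
move=> t; rewrite ltr_norml => /andP[bt tb].
have [|d1 d2] := @continuous_FTC1_closed R f (- b) t b tb _ bt (cf t).
  apply: continuous_compact_integrable; first exact: segment_compact.
  exact: continuous_subspaceT.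
have dH : is_derive t 1 H (f t) by split; [exact: d1|rewrite -derive1E].
rewrite -[f t]subr0; exact: (is_deriveB dH (is_derive_cst (H 0) t 1)).
Qed.

Lemma mvt_bound (G g : R -> R) (b K s t : R) :
  (forall u : R, `|u| < b -> is_derive u 1 G (g u)) ->
  (forall u : R, `|u| < b -> `|g u| <= K) ->
  `|s| < b -> `|t| < b -> `|G s - G t| <= K * `|s - t|.
Proof.
move=> dG gK; wlog st : s t / s <= t => [W sb tb|sb tb].
  have [st|/ltW ts] := leP s t; first exact: W.
  by rewrite distrC (distrC s); exact: W.
have inb (u : R) : s <= u <= t -> `|u| < b.
  move: sb tb; rewrite !ltr_norml => /andP[? ?] /andP[? ?] /andP[? ?].
  by apply/andP; split; lra.
have [||c] := @MVT_segment R G g s t st.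
- by move=> u; rewrite in_itv /= => /andP[/ltW ? /ltW ?]; apply/dG/inb/andP.
- apply: continuous_in_subspaceT => u; rewrite inE /= in_itv /= => /inb /dG[+ _].
  by move=> /derivable1_diffP/differentiable_continuous.
rewrite in_itv /= => /inb cb; rewrite distrC => ->.
by rewrite normrM distrC ler_wpM2r// gK.
Qed.

Lemma le_geometric (a b c : R) : (forall k : nat, a <= b + c / 2 ^+ k) -> a <= b.
Proof.
move=> H; rewrite leNgt; apply/negP => ba.
have d0 : 0 < a - b by rewrite subr_gt0.
pose k := Num.truncn (`|c| / (a - b)).
have kc : `|c| / (a - b) < k.+1%:R by exact: truncnS_gt.
have k2 : k.+1%:R <= 2 ^+ k.+1 :> R by rewrite -natrX ler_nat ltnW// ltn_expl.
have := H k.+1; rewrite -lerBlDl; apply/negP; rewrite -ltNge.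
rewrite ltr_pdivrMr ?exprn_gt0//; apply: le_lt_trans (ler_norm _) _.
by rewrite mulrC -ltr_pdivrMr//; exact: lt_le_trans kc k2.
Qed.

Lemma interval_point (u d : nat -> R) :
  (forall k m, `|u (k + m)%N - u k| <= d k) ->
  exists l, forall k, `|l - u k| <= d k.
Proof.
move=> H.
have ub k m : u k - d k <= u m + d m.
  have := H k m; have := H m k; rewrite addnC.
  move: (u (k + m)%N) => v; rewrite !ler_norml => /andP[? ?] /andP[? ?]; lra.
pose E := [set u k - d k | k in [set: nat]].
have E0 : E !=set0 by exists (u 0%N - d 0%N); exists 0%N.
have Eub m : ubound E (u m + d m) by move=> _ [k _ <-].
exists (sup E) => k; rewrite ler_distl; apply/andP; split.
  by apply: ub_le_sup; [exists (u 0%N + d 0%N)|exists k].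
by apply: ge_sup.
Qed.

Definition clamp (e t : R) : R := Num.max (- e) (Num.min t e).

Lemma clampE e t : `|t| <= e -> clamp e t = t.
Proof. by rewrite ler_norml => /andP[? ?]; rewrite /clamp min_l// max_r. Qed.

Lemma clamp_le e t : 0 <= e -> `|clamp e t| <= e.
Proof.
move=> e0; rewrite ler_norml /clamp le_max lexx /= ge_max ge_min lexx orbT andbT.
by rewrite -subr_ge0 opprK addr_ge0.
Qed.

Lemma clamp_lipschitz (e t s : R) : 0 <= e ->
  `|clamp e t - clamp e s| <= `|t - s|.
Proof.
rewrite /clamp => e0; wlog ts : t s / t <= s => [W|].
  by have [/W//|/ltW/W] := leP t s; rewrite distrC (distrC s).
rewrite distrC (distrC t) (@ger0_norm _ (s - t)) ?subr_ge0//.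
by case: (leP s e) => ?; case: (leP t e) => ?; case: (leP (- e) t) => ?;
  case: (leP (- e) s) => ?; case: (leP (- e) e) => ?;
  rewrite ger0_norm ?subr_ge0 ?lexx//; lra.
Qed.

(* The index type is arbitrary and the sup norm is never formed: the Lipschitz
   condition is stated coordinatewise. *)
Variables (I : Type) (F : (I -> R) -> I -> R) (B L : R).
Hypothesis F_bounded : forall y i, `|F y i| <= B.
Hypothesis F_lipschitz : forall y z (d : R), (forall i, `|y i - z i| <= d) ->
  forall i, `|F y i - F z i| <= L * d.

Lemma picard_lindelof (y0 : I -> R) (e : R) :
  0 <= B -> 0 <= L -> 0 < e -> e * L <= 2^-1 ->
  exists y : R -> I -> R, [/\ y 0 = y0,
    forall t i, `|y t i - y0 i| <= B * e &
    forall (t : R) i, `|t| < e -> is_derive t 1 (fun s => y s i) (F (y t) i)].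
Proof.
move=> B0 L0 e0 eL.
have e20 : 0 < e *+ 2 by rewrite mulr2n addr_gt0.
have [Phi PhiP] := @choice _ _ (fun (f : R -> R) (G : R -> R) => continuous f ->
    G 0 = 0 /\ forall t : R, `|t| < e *+ 2 -> is_derive t 1 G (f t))
  ltac:(by move=> f; have [cf|cf] := pselect (continuous f);
    [have [G HG] := primitive_exists e20 cf; exists G|exists (fun=> 0)]).
have clamp0 : clamp e 0 = 0 by apply: clampE; rewrite normr0 ltW.
have clamp_lt t : `|clamp e t| < e *+ 2.
  by apply: le_lt_trans (clamp_le _ (ltW e0)) _; rewrite mulr2n ltrDl.
have clamp_lip t s : `|clamp e t - clamp e s| <= `|t - s|.
  exact: clamp_lipschitz (ltW e0).
pose T (y : R -> I -> R) t i := y0 i + Phi (fun s => F (y s) i) (clamp e t).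
pose lip (y : R -> I -> R) := forall t s i, `|y t i - y s i| <= B * `|t - s|.
have cont y i : lip y -> continuous (fun s => F (y s) i).
  move=> ly t; apply/cvgrPdist_lt => d d0.
  have LB : 0 < L * B + 1 by rewrite ltr_pwDr// mulr_ge0.
  near=> s.
  apply: (@le_lt_trans _ _ (L * (B * `|t - s|))); first exact: F_lipschitz.
  apply: (@le_lt_trans _ _ ((L * B + 1) * `|t - s|)).
    by rewrite mulrA ler_wpM2r// lerDl.
  rewrite mulrC -ltr_pdivlMr//; near: s.
  by apply: cvgr_dist_lt; [exact: cvg_id|rewrite divr_gt0].
have dPhi (y : R -> I -> R) i (t : R) : lip y -> `|t| < e *+ 2 ->
    is_derive t 1 (Phi (fun s => F (y s) i)) (F (y t) i).
  by move=> ly; have [_] := PhiP _ (cont y i ly); apply.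
have PhiB (y : R -> I -> R) i (a b : R) : lip y -> `|a| < e *+ 2 -> `|b| < e *+ 2 ->
    `|Phi (fun s => F (y s) i) a - Phi (fun s => F (y s) i) b| <= B * `|a - b|.
  move=> ly ab bb; apply: (mvt_bound (b := e *+ 2) (g := fun u => F (y u) i)) => // u.
  exact: dPhi.
have lipT y : lip y -> lip (T y).
  move=> ly t s i; rewrite /T opprD addrACA subrr add0r.
  apply: (@le_trans _ _ (B * `|clamp e t - clamp e s|)).
    exact: PhiB.
  by rewrite ler_wpM2l.
have T0 y : lip y -> T y 0 = y0.
  move=> ly; apply/funext => i; rewrite /T clampE ?normr0 ?ltW//.
  by have [-> _] := PhiP _ (cont y i ly); rewrite addr0.
have contr (y z : R -> I -> R) (d : R) : lip y -> lip z -> (forall t i, `|y t i - z t i| <= d) ->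
    forall t i, `|T y t i - T z t i| <= d / 2.
  move=> ly lz yz t i; rewrite /T opprD addrACA subrr add0r.
  have d0 : 0 <= d by exact: le_trans (yz t i).
  pose G := fun u => Phi (fun s => F (y s) i) u - Phi (fun s => F (z s) i) u.
  have G0 : G 0 = 0.
    rewrite /G; have [-> _] := PhiP _ (cont y i ly).
    by have [-> _] := PhiP _ (cont z i lz); rewrite subrr.
  have -> : Phi (fun s => F (y s) i) (clamp e t) -
    Phi (fun s => F (z s) i) (clamp e t) = G (clamp e t) - G 0.
    by rewrite G0 subr0.
  apply: (@le_trans _ _ (L * d * `|clamp e t - 0|)).
    apply: (mvt_bound (b := e *+ 2) (g := fun u => F (y u) i - F (z u) i)) => //.
    - by move=> u ub; apply: is_deriveB; exact: dPhi.
    - by move=> u ub; apply: F_lipschitz.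
    - by rewrite normr0.
  rewrite subr0; apply: (@le_trans _ _ (L * d * e)).
    by rewrite ler_wpM2l ?mulr_ge0 ?clamp_le ?(ltW e0).
  by rewrite mulrAC (mulrC L) [leRHS]mulrC ler_wpM2r.
pose Y k := iter k T (fun _ => y0).
have lipY k : lip (Y k).
  elim: k => [|k IH]; last exact: lipT.
  by move=> t s i; rewrite subrr normr0 mulr_ge0.
have step k t i : `|Y k.+1 t i - Y k t i| <= B * e / 2 ^+ k.
  elim: k t i => [|k IH] t i.
    rewrite /Y/= expr0 divr1 -[X in _ - X](_ : T (fun=> y0) 0 i = _); last first.
      by rewrite T0//; exact: (lipY 0%N).
    rewrite /T opprD addrACA subrr add0r.
    apply: (@le_trans _ _ (B * `|clamp e t - clamp e 0|)).
      by apply: PhiB => //; exact: (lipY 0%N).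
    by rewrite clamp0 subr0 ler_wpM2l ?clamp_le ?(ltW e0).
  by rewrite exprSr invfM mulrA; apply: (contr (Y k.+1) (Y k)).
have far k m t i : `|Y (k + m)%N t i - Y k t i| <= B * e *+ 2 / 2 ^+ k.
  elim: m k => [|m IH] k.
    by rewrite addn0 subrr normr0 divr_ge0 ?exprn_ge0// mulrn_wge0// mulr_ge0// ltW.
  rewrite addnS -addSn -(subrKA (Y k.+1 t i)) (le_trans (ler_normD _ _))//.
  apply: (le_trans (lerD (IH k.+1) (step k t i))).
  rewrite exprSr invfM; lra.
have [y yP] : exists y : R -> I -> R, forall k t i,
    `|y t i - Y k t i| <= B * e *+ 2 / 2 ^+ k.
  have [y yP] := @choice _ _ (fun (ti : R * I) l => forall k,
    `|l - Y k ti.1 ti.2| <= B * e *+ 2 / 2 ^+ k)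
    (fun ti => interval_point (fun k m => far k m ti.1 ti.2)).
  by exists (fun t i => y (t, i)) => k t i; exact: (yP (t, i)).
have lipy : lip y.
  move=> t s i; apply: (@le_geometric _ _ (B * e *+ 4)) => k.
  have h1 := ler_distD (Y k t i) (y t i) (y s i).
  have h2 := ler_distD (Y k s i) (Y k t i) (y s i).
  have h3 := yP k t i; have h4 := yP k s i; have h5 := lipY k t s i.
  rewrite (distrC (Y k s i)) in h2.
  move: h1 h2 h3 h4 h5; rewrite !mulrnAl.
  move: (B * _) (B * e / _) (`|_|) (`|_|) (`|_|) (`|_|) (`|_|) => *; lra.
have yT : y = T y.
  apply/funext => t; apply/funext => i; apply/eqP; rewrite -subr_eq0 -normr_le0.
  apply: (@le_geometric _ _ (B * e *+ 2)) => k; rewrite add0r.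
  have h1 := ler_distD (Y k.+1 t i) (y t i) (T y t i).
  have h2 := yP k.+1 t i.
  have h3 : `|Y k.+1 t i - T y t i| <= B * e *+ 2 / 2 ^+ k / 2.
    by apply: contr => // u j; rewrite distrC; exact: yP.
  move: h1 h2 h3; rewrite exprSr invfM !mulrA !mulrnAl.
  move: (B * e / _) (`|_|) (`|_|) (`|_|) => *; lra.
exists y; split.
- by rewrite yT T0.
- move=> t i; rewrite yT -[X in _ - X i](T0 _ lipy) /T opprD addrACA subrr add0r.
  apply: (@le_trans _ _ (B * `|clamp e t - clamp e 0|)).
    exact: PhiB.
  by rewrite clamp0 subr0 ler_wpM2l ?clamp_le ?(ltW e0).
- move=> t i te.
  have D : is_derive t 1 (fun s => y0 i + Phi (fun s => F (y s) i) s) (F (y t) i).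
    rewrite -[F (y t) i]add0r; apply: is_deriveD.
    by apply: dPhi => //; apply: lt_trans te _; rewrite mulr2n ltrDl.
  apply: near_eq_is_derive D; near=> s.
  rewrite [in RHS]yT /T clampE// ltW//; near: s.
  by apply: (cvgr_norm_lt t); [exact: cvg_id|].
Unshelve. all: by end_near. Qed.

End Ode.

(** * Christoffel symbols and curvature of a commuting null frame *)

Section FrameAlgebra.
Variable K : fieldType.
Implicit Types E T A B : 'I_2 -> 'I_2 -> K.

Definition dual_frame E (m a : 'I_2) : K :=
  (if m == 0 then (if a == 0 then E 1 1 else - E 1 0)
   else (if a == 0 then - E 0 1 else E 0 0)) / (E 0 0 * E 1 1 - E 0 1 * E 1 0).

Lemma dual_frameK E (m n : 'I_2) : E 0 0 * E 1 1 - E 0 1 * E 1 0 != 0 ->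
  \sum_k dual_frame E m k * E n k = (m == n)%:R.
Proof.
move=> D; rewrite sum2E /dual_frame.
by case: (ord2P m) => ->; case: (ord2P n) => -> /=; field.
Qed.

Lemma frame_dualK E (k j : 'I_2) : E 0 0 * E 1 1 - E 0 1 * E 1 0 != 0 ->
  \sum_m E m k * dual_frame E m j = (k == j)%:R.
Proof.
move=> D; rewrite sum2E /dual_frame.
by case: (ord2P k) => ->; case: (ord2P j) => -> /=; field.
Qed.

Lemma null_gram E T G (f : K) :
  (forall k j, \sum_m E m k * T m j = (k == j)%:R) ->
  (forall m n, \sum_a \sum_b E m a * G a b * E n b = (m != n)%:R * f) ->
  forall a b, G a b = f * (T 0 a * T 1 b + T 1 a * T 0 b).
Proof.
move=> ET EG a b.
have e k j : E 0 k * T 0 j + E 1 k * T 1 j = (k == j)%:R by rewrite -ET sum2E.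
have g m n : E m 0 * G 0 0 * E n 0 + E m 0 * G 0 1 * E n 1 +
    (E m 1 * G 1 0 * E n 0 + E m 1 * G 1 1 * E n 1) = (m != n)%:R * f.
  by rewrite -EG !sum2E.
transitivity (\sum_m \sum_n (\sum_c \sum_d E m c * G c d * E n d) * T m a * T n b).
  transitivity (\sum_c \sum_d (\sum_m E m c * T m a) * G c d * (\sum_n E n d * T n b)).
    rewrite !sum2E !e.
    by case: (ord2P a) => ->; case: (ord2P b) => -> /=; ring.
  by rewrite !sum2E; ring.
by rewrite !sum2E !g /=; ring.
Qed.

Lemma frame_inverse_metric E T G (f : K) : f != 0 ->
  (forall k j, \sum_m E m k * T m j = (k == j)%:R) ->
  (forall m n, \sum_k T m k * E n k = (m == n)%:R) ->
  (forall a b, G a b = f * (T 0 a * T 1 b + T 1 a * T 0 b)) ->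
  forall a k, \sum_l G a l * ((E 0 l * E 1 k + E 1 l * E 0 k) / f) = (a == k)%:R.
Proof.
move=> f0 ET TE GE a k.
have e : E 0 k * T 0 a + E 1 k * T 1 a = (a == k)%:R by rewrite eq_sym -ET sum2E.
have t m n : T m 0 * E n 0 + T m 1 * E n 1 = (m == n)%:R by rewrite -TE sum2E.
transitivity (f / f * (T 0 a * (E 1 k * (T 1 0 * E 0 0 + T 1 1 * E 0 1) +
                               E 0 k * (T 1 0 * E 1 0 + T 1 1 * E 1 1))
             + T 1 a * (E 1 k * (T 0 0 * E 0 0 + T 0 1 * E 0 1) +
                        E 0 k * (T 0 0 * E 1 0 + T 0 1 * E 1 1)))).
  by rewrite sum2E !GE; ring.
by rewrite !t divff//= -e; ring.
Qed.

Lemma christoffel_unique G Ginv (dG C : 'I_2 -> 'I_2 -> 'I_2 -> K) :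
  (2 : K) != 0 ->
  (forall a b, G a b = G b a) ->
  (forall k d, \sum_l Ginv k l * G l d = (k == d)%:R) ->
  (forall k a b, C k a b = C k b a) ->
  (forall c a b, dG c a b =
     \sum_d (C d c a * G d b) + \sum_d (C d c b * G a d)) ->
  forall k a b,
    2^-1 * \sum_l Ginv k l * (dG a l b + dG b l a - dG l a b) = C k a b.
Proof.
move=> two Gsym inv Csym dGE k a b.
have i2 d : Ginv k 0 * G 0 d + Ginv k 1 * G 1 d = (k == d)%:R.
  by rewrite -inv sum2E.
have low l : dG a l b + dG b l a - dG l a b = 2 * \sum_d G l d * C d a b.
  rewrite !dGE !sum2E (Csym 0 l a) (Csym 1 l a) (Csym 0 l b) (Csym 1 l b).
  by rewrite (Csym 0 b a) (Csym 1 b a) (Gsym a 0) (Gsym a 1); ring.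
rewrite !sum2E !low !sum2E.
transitivity ((Ginv k 0 * G 0 0 + Ginv k 1 * G 1 0) * C 0 a b +
   (Ginv k 0 * G 0 1 + Ginv k 1 * G 1 1) * C 1 a b); first by field.
by rewrite !i2; case: (ord2P k) => -> /=; ring.
Qed.

Lemma frame_torsion_free E T (dE0 dE1 : 'I_2 -> 'I_2 -> K) (a b : 'I_2 -> 'I_2 -> K) m :
  E 0 0 * E 1 1 - E 0 1 * E 1 0 != 0 ->
  (forall n, \sum_k a m k * E n k = - \sum_k T m k * dE0 n k) ->
  (forall n, \sum_k b m k * E n k = - \sum_k T m k * dE1 n k) ->
  (forall k, E 0 0 * dE0 1 k + E 0 1 * dE1 1 k - (E 1 0 * dE0 0 k + E 1 1 * dE1 0 k) = 0) ->
  a m 1 = b m 0.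
Proof.
move=> D aE bE com; apply/eqP; rewrite -subr_eq0 -(mulIr_eq0 _ (mulIf D)); apply/eqP.
have := com 0; have := com 1; have := aE 0; have := aE 1; have := bE 0; have := bE 1.
rewrite !sum2E => b1 b0 a1 a0 c1 c0.
transitivity (E 0 0 * (a m 0 * E 1 0 + a m 1 * E 1 1) + E 0 1 * (b m 0 * E 1 0 + b m 1 * E 1 1)
  - (E 1 0 * (a m 0 * E 0 0 + a m 1 * E 0 1) + E 1 1 * (b m 0 * E 0 0 + b m 1 * E 0 1))).
  by ring.
rewrite a0 a1 b0 b1.
transitivity (- (T m 0 * (E 0 0 * dE0 1 0 + E 0 1 * dE1 1 0 - (E 1 0 * dE0 0 0 + E 1 1 * dE1 0 0))
  + T m 1 * (E 0 0 * dE0 1 1 + E 0 1 * dE1 1 1 - (E 1 0 * dE0 0 1 + E 1 1 * dE1 0 1)))).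
  by ring.
by rewrite c0 c1; ring.
Qed.

Lemma frame_metric_compat E T G (t : 'I_2 -> 'I_2 -> K) (f df : K) (w : 'I_2 -> K)
    (U : 'I_2 -> 'I_2 -> K) (c : 'I_2) :
  f != 0 ->
  (forall m n, \sum_k T m k * E n k = (m == n)%:R) ->
  (forall a b, G a b = f * (T 0 a * T 1 b + T 1 a * T 0 b)) ->
  df = \sum_m T m c * w m ->
  (forall d a, U d a = \sum_m E m d * t m a +
     \sum_m T m c * T m a * (w m / f) * E m d) ->
  forall a b,
  df * (T 0 a * T 1 b + T 1 a * T 0 b) + f * (t 0 a * T 1 b + T 0 a * t 1 b
     + (t 1 a * T 0 b + T 1 a * t 0 b)) =
  \sum_d U d a * G d b + \sum_d U d b * G a d.
Proof.
move=> f0 TE GE dfE UE a b.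
have tE m n : T m 0 * E n 0 + T m 1 * E n 1 = (m == n)%:R by rewrite -TE sum2E.
have UG p q : \sum_d U d p * (f * (T 0 d * T 1 q + T 1 d * T 0 q)) =
   f * (t 0 p * T 1 q + t 1 p * T 0 q) + T 0 c * T 0 p * w 0 * T 1 q
   + T 1 c * T 1 p * w 1 * T 0 q.
  transitivity (
   f * (((T 0 0 * E 0 0 + T 0 1 * E 0 1) * t 0 p + (T 0 0 * E 1 0 + T 0 1 * E 1 1) * t 1 p) * T 1 q
   + ((T 1 0 * E 0 0 + T 1 1 * E 0 1) * t 0 p + (T 1 0 * E 1 0 + T 1 1 * E 1 1) * t 1 p) * T 0 q)
   + (f / f) * ((T 0 c * T 0 p * w 0 * (T 0 0 * E 0 0 + T 0 1 * E 0 1) +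
        T 1 c * T 1 p * w 1 * (T 0 0 * E 1 0 + T 0 1 * E 1 1)) * T 1 q
      + (T 0 c * T 0 p * w 0 * (T 1 0 * E 0 0 + T 1 1 * E 0 1) +
        T 1 c * T 1 p * w 1 * (T 1 0 * E 1 0 + T 1 1 * E 1 1)) * T 0 q)).
    by rewrite sum2E !UE !sum2E; ring.
  by rewrite !tE divff//=; ring.
transitivity (\sum_d U d a * (f * (T 0 d * T 1 b + T 1 d * T 0 b)) +
  \sum_d U d b * (f * (T 0 d * T 1 a + T 1 d * T 0 a))); last first.
  by rewrite !sum2E !GE; ring.
by rewrite !UG dfE sum2E; ring.
Qed.

Lemma frame_curvature E A B (EA EB : 'I_2 -> 'I_2 -> K) (H : 'I_2 -> K) (l k : 'I_2) :
  (forall m l, EA m l = - \sum_n \sum_j E n l * A n j * E m j) ->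
  (forall m l, EB m l = - \sum_n \sum_j E n l * B n j * E m j) ->
  \sum_m (EA m l * B m k + E m l * H m) - \sum_m (EB m l * A m k + E m l * H m) +
  \sum_j ((\sum_m E m l * A m j) * (\sum_m E m j * B m k)
          - (\sum_m E m l * B m j) * (\sum_m E m j * A m k)) = 0.
Proof. by move=> hA hB; rewrite !sum2E !hA !hB !sum2E; ring. Qed.

End FrameAlgebra.

Lemma pd_sum2M (R : realType) (u v : 'I_2 -> 'rV[R]_2 -> R) (x : 'rV[R]_2) a :
  (forall k, derivable (u k) x (delta_mx 0 a)) ->
  (forall k, derivable (v k) x (delta_mx 0 a)) ->
  pd a (fun y => u 0 y * v 0 y + u 1 y * v 1 y) x =
  \sum_k (pd a (u k) x * v k x + u k x * pd a (v k) x).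
Proof.
move=> du dv.
have d k := derivableM (du k) (dv k).
rewrite sum2E (@pdD _ (fun y => u 0 y * v 0 y) (fun y => u 1 y * v 1 y) x a (d 0) (d 1)).
by rewrite !pdM.
Qed.

Lemma pd_sym_product (R : realType) (f u v u' v' : 'rV[R]_2 -> R) (x : 'rV[R]_2) c :
  derivable f x (delta_mx 0 c) ->
  derivable u x (delta_mx 0 c) -> derivable v x (delta_mx 0 c) ->
  derivable u' x (delta_mx 0 c) -> derivable v' x (delta_mx 0 c) ->
  pd c (fun y => f y * (u y * v y + u' y * v' y)) x =
  pd c f x * (u x * v x + u' x * v' x) +
  f x * (pd c u x * v x + u x * pd c v x + (pd c u' x * v' x + u' x * pd c v' x)).
Proof.
move=> df du dv du' dv'.
have d := derivableM du dv; have d' := derivableM du' dv'.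
rewrite (pdM df (derivableD d d')); congr (_ + _ * _).
by rewrite (pdD d d') (pdM du dv) (pdM du' dv').
Qed.

Section NullFrame.
Variables (R : realType) (M : topologicalType) (S : oriented_surface R M).
Variables (h : chart S -> M -> 'M[R]_2) (i : chart S) (W : set 'rV[R]_2).
Variables (E : 'I_2 -> 'I_2 -> 'rV[R]_2 -> R) (f : 'rV[R]_2 -> R).
Hypothesis oW : open W.
Hypothesis CE : forall m k, Ck 2 W (E m k).
Hypothesis Cf : Ck 1 W f.
Hypothesis f0 : forall x, W x -> f x != 0.
Hypothesis indep : forall x, W x -> E 0 0 x * E 1 1 x - E 0 1 x * E 1 0 x != 0.
Hypothesis commuting : forall x k, W x ->
  \sum_a (E 0 a x * pd a (E 1 k) x - E 1 a x * pd a (E 0 k) x) = 0.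
Hypothesis gram : forall x m n, W x ->
  \sum_a \sum_b E m a x * h i (pnt i x) a b * E n b x = (m != n)%:R * f x.

Let th m a x := dual_frame (fun m k => E m k x) m a.

Lemma Ck_dual_frame m a : Ck 2 W (th m a).
Proof.
have CD : Ck 2 W (fun x => (E 0 0 x * E 1 1 x - E 0 1 x * E 1 0 x)^-1).
  apply: (CkV oW indep).
  exact: (CkD oW (CkM oW (CE 0 0) (CE 1 1)) (CkN oW (CkM oW (CE 0 1) (CE 1 0)))).
by case: (ord2P m) => ->; case: (ord2P a) => ->;
  [exact: (CkM oW (CE 1 1) CD)|exact: (CkM oW (CkN oW (CE 1 0)) CD)
  |exact: (CkM oW (CkN oW (CE 0 1)) CD)|exact: (CkM oW (CE 0 0) CD)].
Qed.

Lemma pd_dual_frame x a m n : W x ->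
  \sum_k pd a (th m k) x * E n k x = - \sum_k th m k x * pd a (E n k) x.
Proof.
move=> Wx; apply/eqP; rewrite -subr_eq0 opprK; apply/eqP.
have dth k : derivable (th m k) x (delta_mx 0 a).
  exact: Ck_derivable (Ck_dual_frame m k) Wx.
have dE k : derivable (E n k) x (delta_mx 0 a) by exact: Ck_derivable (CE n k) Wx.
have : pd a (fun y => th m 0 y * E n 0 y + th m 1 y * E n 1 y) x = 0.
  apply: (etrans _ (pd_cst (m == n)%:R x a)); apply: (pd_ext _ oW _ Wx) => y Wy.
  by rewrite -(@dual_frameK _ (fun m k => E m k y) m n (indep Wy)) sum2E.
by rewrite (@pd_sum2M _ (th m) (E n) _ _ dth dE) big_split.
Qed.

Lemma christoffel_frame x k a b : W x ->
  christoffel h i k a b x = \sum_m E m k x * pd a (th m b) x +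
    \sum_m th m a x * th m b x * ((\sum_c E m c x * pd c f x) / f x) * E m k x.
Proof.
move=> Wx.
have ET k' j : \sum_m E m k' x * th m j x = (k' == j)%:R.
  exact: (@frame_dualK _ (fun m k => E m k x) _ _ (indep Wx)).
have TE m n : \sum_k th m k x * E n k x = (m == n)%:R.
  exact: (@dual_frameK _ (fun m k => E m k x) _ _ (indep Wx)).
have GE y a' b' : W y ->
    h i (pnt i y) a' b' = f y * (th 0 a' y * th 1 b' y + th 1 a' y * th 0 b' y).
  move=> Wy; apply: (@null_gram _ (fun m k => E m k y) (fun m k => th m k y)
    (fun a b => h i (pnt i y) a b)).
    by move=> k' j; exact: (@frame_dualK _ (fun m k => E m k y) _ _ (indep Wy)).
  by move=> m n; exact: gram.
have dth m k' c : derivable (th m k') x (delta_mx 0 c).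
  exact: Ck_derivable (Ck_dual_frame m k') Wx.
have df c : derivable f x (delta_mx 0 c) by exact: Ck_derivable Cf Wx.
have closed m : pd 0 (th m 1) x = pd 1 (th m 0) x.
  apply: (@frame_torsion_free _ (fun m k => E m k x) (fun m k => th m k x)
    (fun m k => pd 0 (E m k) x) (fun m k => pd 1 (E m k) x)
    (fun m k => pd 0 (th m k) x) (fun m k => pd 1 (th m k) x)).
  - exact: indep.
  - by move=> n; exact: pd_dual_frame.
  - by move=> n; exact: pd_dual_frame.
  - by move=> k'; have := commuting k' Wx; rewrite sum2E opprD addrACA.
pose w m := \sum_c E m c x * pd c f x.
pose C (k a b : 'I_2) := \sum_m E m k x * pd a (th m b) x +
    \sum_m th m a x * th m b x * (w m / f x) * E m k x.
have inv k' d : \sum_l invmx (h i (pnt i x)) k' l * h i (pnt i x) l d = (k' == d)%:R.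
  pose N := \matrix_(l, k) ((E 0 l x * E 1 k x + E 1 l x * E 0 k x) / f x).
  have : h i (pnt i x) *m N = 1%:M.
    apply/matrixP => a' b'; rewrite !mxE.
    rewrite -(@frame_inverse_metric _ (fun m k => E m k x) (fun m k => th m k x)
      (fun a b => h i (pnt i x) a b) (f x) (f0 Wx) ET TE (fun a b => GE x a b Wx) a' b').
    by apply: eq_bigr => l _; rewrite !mxE.
  move=> /mulmx1_unit[u _].
  by have := congr1 (fun A : 'M[R]_2 => A k' d) (mulVmx u); rewrite !mxE.
rewrite -[RHS]/(C k a b).
apply: (@christoffel_unique _ (fun a b => h i (pnt i x) a b)
  (fun k l => invmx (h i (pnt i x)) k l)
  (fun c a b => pd c (fun y => h i (pnt i y) a b) x) C).
- by rewrite pnatr_eq0.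
- by move=> a' b'; rewrite !GE//; congr (_ * _); ring.
- exact: inv.
- move=> k' a' b'; rewrite /C; congr (_ + _); last first.
    by apply: eq_bigr => m _; congr (_ * _ * _); rewrite mulrC.
  apply: eq_bigr => m _; congr (_ * _).
  by case: (ord2P a') => ->; case: (ord2P b') => ->; rewrite ?closed.
move=> c a' b'.
rewrite -(@frame_metric_compat _ (fun m k => E m k x) (fun m k => th m k x)
  (fun a b => h i (pnt i x) a b) (fun m k => pd c (th m k) x) (f x) (pd c f x) w
  (fun d a => C d c a) c (f0 Wx) TE (fun a b => GE x a b Wx)).
- rewrite (@pd_ext _ W _ (fun y => f y * (th 0 a' y * th 1 b' y + th 1 a' y * th 0 b' y)))//;
    last by move=> y; exact: GE.
  exact: (pd_sym_product (df c) (dth 0 a' c) (dth 1 b' c) (dth 1 a' c) (dth 0 b' c)).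
- rewrite /w !sum2E.
  transitivity ((\sum_m E m 0 x * th m c x) * pd 0 f x + (\sum_m E m 1 x * th m c x) * pd 1 f x).
    by rewrite !ET; case: (ord2P c) => -> /=; ring.
  by rewrite !sum2E; ring.
- by move=> d a''; rewrite /C.
Qed.

Lemma riemann_frame_eq0 x l k a b : W x -> (forall y c, W y -> pd c f y = 0) ->
  riemann h i l k a b x = 0.
Proof.
move=> Wx dfc.
have dE m k' c : derivable (E m k') x (delta_mx 0 c) by exact: Ck_derivable (CE m k') Wx.
have dth m k' c d : derivable (pd c (th m k')) x (delta_mx 0 d).
  exact: Ck_derivable (Ck_pd c (Ck_dual_frame m k')) Wx.
have christ y k' a' b' : W y ->
    christoffel h i k' a' b' y = E 0 k' y * pd a' (th 0 b') y + E 1 k' y * pd a' (th 1 b') y.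
  move=> Wy; rewrite christoffel_frame// -[RHS]addr0; congr (_ + _); first by rewrite sum2E.
  rewrite big1// => m _; rewrite (eq_bigr (fun=> 0)).
    by rewrite big1// mul0r mulr0 mul0r.
  by move=> c _; rewrite dfc// mulr0.
have pdE c m l' : pd c (E m l') x = - \sum_n \sum_j E n l' x * pd c (th n j) x * E m j x.
  have ET k' j : \sum_m E m k' x * th m j x = (k' == j)%:R.
    exact: (@frame_dualK _ (fun m k => E m k x) _ _ (indep Wx)).
  transitivity (\sum_n E n l' x * \sum_j th n j x * pd c (E m j) x).
    transitivity (\sum_j (\sum_n E n l' x * th n j x) * pd c (E m j) x).
      by rewrite !sum2E -!(sum2E (fun n => E n _ x * th n _ x)) !ET;
        case: (ord2P l') => -> /=; ring.
    by rewrite !sum2E; ring.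
  rewrite -sumrN; apply: eq_bigr => n _.
  rewrite -[\sum_j _]opprK -pd_dual_frame// mulrN; congr (- _).
  by rewrite big_distrr /=; apply: eq_bigr => j _; rewrite mulrA.
have dchrist c k' a' b' : pd c (christoffel h i k' a' b') x =
    \sum_m (pd c (E m k') x * pd a' (th m b') x + E m k' x * pd c (pd a' (th m b')) x).
  rewrite (@pd_ext _ W _ (fun y => E 0 k' y * pd a' (th 0 b') y + E 1 k' y * pd a' (th 1 b') y))//;
    last by move=> y; exact: christ.
  exact: (@pd_sum2M _ (fun m => E m k') (fun m => pd a' (th m b'))).
have sch m : pd b (pd a (th m k)) x = pd a (pd b (th m k)) x.
  have e01 := schwarz oW (Ck_dual_frame m k) Wx.
  by case: (ord2P a) => ->; case: (ord2P b) => ->;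
    [reflexivity|exact: esym e01|exact: e01|reflexivity].
have dchrist' : pd b (christoffel h i l a k) x = \sum_m
    (pd b (E m l) x * pd a (th m k) x + E m l x * pd a (pd b (th m k)) x).
  by rewrite dchrist; apply: eq_bigr => m _; rewrite sch.
rewrite /riemann dchrist dchrist'.
apply: etrans (@frame_curvature _ (fun m k => E m k x) (fun m k => pd a (th m k) x)
  (fun m k => pd b (th m k) x) (fun m k => pd a (E m k) x) (fun m k => pd b (E m k) x)
  (fun m => pd a (pd b (th m k)) x) l k (pdE a) (pdE b)).
apply: f_equal2; first by [].
by apply: eq_bigr => m _; rewrite !(christ _ _ _ _ Wx) !sum2E.
Qed.

End NullFrame.

(** * Charts *)

Section Charts.
Variables (R : realType) (M : topologicalType) (S : oriented_surface R M).
Implicit Types (i j : chart S) (p : M) (U : set M).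

Definition img i U : set 'rV[R]_2 := crd i @` (dom i `&` U).

Lemma imgP i U x : img i U x -> [/\ dom i (pnt i x), U (pnt i x) & crd i (pnt i x) = x].
Proof. by move=> [p [dp Up] <-]; rewrite crdK. Qed.

Lemma img_crd i U p : dom i p -> U p -> img i U (crd i p).
Proof. by move=> dp Up; exists p. Qed.

Lemma open_img i U : open U -> open (img i U).
Proof.
move=> oU; rewrite openE => x [p [dp Up] xp].
have nU : nbhs p U by exact: open_nbhs_nbhs.
have ix : (crd i @` dom i) x by exists p.
have np : pnt i x = p by rewrite -xp crdK.
have nI : \forall y \near x, (crd i @` dom i) y.
  by apply: open_nbhs_nbhs; split=> //; exact: img_open.
have nV : \forall y \near x, U (pnt i y) by apply: (pnt_cont ix); rewrite np.
apply: (filterS2 _ _ nI nV) => y [q dq qy] Uy.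
by exists q => //; split=> //; rewrite -(crdK dq) qy.
Qed.

Lemma near_dom i p : dom i p -> \forall q \near p, dom i q.
Proof. by move=> dp; apply: open_nbhs_nbhs; split=> //; exact: dom_open. Qed.

Lemma curve_chain i U (f : M -> R) (c : R -> M) t (v : 'I_2 -> R) :
  open U -> Ck 1 (img i U) (fun x => f (pnt i x)) ->
  {for t, continuous c} -> dom i (c t) -> U (c t) ->
  (forall k, is_derive t 1 (fun s => crd i (c s) 0 k) (v k)) ->
  is_derive t 1 (fun s => f (c s))
    (\sum_(a < 2) v a * pd a (fun x => f (pnt i x)) (crd i (c t))).
Proof.
move=> oU Cf ct dct Uct dv.
apply: (near_eq_is_derive (f := fun s => f (pnt i (crd i (c s))))).
  have nd : \forall s \near t, dom i (c s) by apply: ct; exact: near_dom.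
  by apply: filterS nd => s ds; rewrite crdK.
apply: (@chain_rule R (img i U) (fun x => f (pnt i x)) (fun s => crd i (c s))) => //.
  exact: open_img.
exact: img_crd.
Qed.

Lemma is_derive_of_line (f : 'rV[R]_2 -> R) (x : 'rV[R]_2) (v : 'rV[R]_2) (d : R) :
  is_derive (0 : R) 1 (fun t : R => f (t *: v + x)) d -> is_derive x v f d.
Proof.
have E : (fun k : R => k^-1 *: (((fun t : R => f (t *: v + x)) \o shift 0) (k *: 1)
    - f (0 *: v + x))) = (fun k : R => k^-1 *: ((f \o shift x) (k *: v) - f x)).
  by apply/funext => k /=; rewrite scale0r add0r addr0 [k *: 1]mulr1.
by move=> [H1 H2]; split; move: H1 H2; rewrite /derivable /derive E.
Qed.

Lemma chart_change i j p U (f : M -> R) (a : 'I_2) :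
  open U -> Ck 1 (img j U) (fun x => f (pnt j x)) ->
  dom i p -> dom j p -> U p ->
  pd a (fun x => f (pnt i x)) (crd i p) =
  \sum_(b < 2) jac i j p a b * pd b (fun x => f (pnt j x)) (crd j p).
Proof.
move=> oU Cf di dj Up; set x := crd i p.
pose e : 'rV[R]_2 := delta_mx 0 a.
pose c (t : R) := pnt i (t *: e + x).
have ix : (crd i @` dom i) (0 *: e + x) by rewrite scale0r add0r; exists p.
have c0 : c 0 = p by rewrite /c scale0r add0r crdK.
have lc : {for (0 : R), continuous (fun t : R => t *: e + x)}.
  by apply: continuousD; [exact: scalel_continuous|exact: cst_continuous].
have cc : {for 0, continuous c}.
  by apply: (continuous_comp lc); exact: pnt_cont.
suff [_ H] : is_derive x e (fun x => f (pnt i x))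
  (\sum_(b < 2) jac i j p a b * pd b (fun x => f (pnt j x)) (crd j p)) by [].
apply: is_derive_of_line; rewrite -[X in crd j X]c0.
apply: (@curve_chain j U f c 0 (fun b => jac i j p a b) oU Cf cc); rewrite ?c0//.
move=> k; rewrite mxE.
have Ct := @trans_smooth _ _ S i j k 1%N.
have d : derivable (fun y => crd j (pnt i y) 0 k) (0 *: e + x) e.
  by apply: (Ck_derivable Ct); rewrite scale0r add0r; exists p.
by have := is_derive_line d; rewrite scale0r add0r.
Qed.

End Charts.

(** * Conformal null frames: conformal flatness and completeness *)

Lemma null_gram_indep (K : fieldType) (E G : 'I_2 -> 'I_2 -> K) (f : K) : f != 0 ->
  (forall m n, \sum_a \sum_b E m a * G a b * E n b = (m != n)%:R * f) ->
  E 0 0 * E 1 1 - E 0 1 * E 1 0 != 0.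
Proof.
move=> f0 EG; apply/eqP => D.
have g m n : E m 0 * G 0 0 * E n 0 + E m 0 * G 0 1 * E n 1 +
    (E m 1 * G 1 0 * E n 0 + E m 1 * G 1 1 * E n 1) = (m != n)%:R * f.
  by rewrite -EG !sum2E.
have : (E 0 0 * E 1 1 - E 0 1 * E 1 0) ^+ 2 * (G 0 0 * G 1 1 - G 0 1 * G 1 0) =
    (0 != 0 :> 'I_2)%:R * f * ((1 != 1 :> 'I_2)%:R * f)
    - (0 != 1 :> 'I_2)%:R * f * ((1 != 0 :> 'I_2)%:R * f).
  pose gr m n := E m 0 * G 0 0 * E n 0 + E m 0 * G 0 1 * E n 1 +
    (E m 1 * G 1 0 * E n 0 + E m 1 * G 1 1 * E n 1).
  transitivity (gr 0 0 * gr 1 1 - gr 0 1 * gr 1 0); first by rewrite /gr; ring.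
  by rewrite /gr !g.
rewrite D expr0n /= !mul0r !mul1r sub0r => /eqP.
by rewrite eq_sym oppr_eq0 mulf_eq0 (negbTE f0).
Qed.

Lemma sum_mulmx (K : comPzRingType) (v : 'rV[K]_2) (A : 'M[K]_2) (u : 'I_2 -> K) :
  \sum_a (v *m A) 0 a * u a = \sum_a v 0 a * \sum_b A a b * u b.
Proof. by rewrite !sum2E !mxE !sum2E; ring. Qed.

Record conformal_null_frame (R : realType) (M : topologicalType)
    (S : oriented_surface R M) (g : lorentz_metric S)
    (V : 'I_2 -> chart S -> M -> 'rV[R]_2) (mu : M -> R) := ConformalNullFrame {
  cnf_trans : forall m (i j : chart S) p, dom i p -> dom j p ->
    V m j p = V m i p *m jac i j p;
  cnf_smooth : forall m i k, smooth_in i setT (fun p => V m i p 0 k);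
  cnf_mu_smooth : smooth_fun S mu;
  cnf_mu_gt0 : forall p, 0 < mu p;
  cnf_gram : forall m n i p, dom i p ->
    pairing (g i p) (V m i p) (V n i p) = (m != n)%:R * (- 2 * mu p);
  cnf_commute : forall i p, dom i p -> forall k, \sum_a
    (V 0 i p 0 a * pd a (fun x => V 1 i (pnt i x) 0 k) (crd i p)
     - V 1 i p 0 a * pd a (fun x => V 0 i (pnt i x) 0 k) (crd i p)) = 0
}.

Lemma C1_lipschitz_fam (R : realType) (J : finType) (W : set 'rV[R]_2)
    (f : J -> 'rV[R]_2 -> R) (z : 'rV[R]_2) :
  open W -> (forall j, Ck 1 W (f j)) -> W z ->
  exists r L B : R, [/\ 0 < r, 0 <= L, 0 <= B, box z r `<=` W &
    forall j, (forall x, box z r x -> `|f j x| <= B) /\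
    forall x y (d : R), box z r x -> box z r y -> (forall a, `|x 0 a - y 0 a| <= d) ->
      `|f j x - f j y| <= L * d].
Proof.
move=> oW Cf Wz.
have [q qP] := @choice _ _ (fun j (q : R * R * R) =>
  [/\ 0 < q.1.1, 0 <= q.1.2, box z q.1.1 `<=` W,
    forall x, box z q.1.1 x -> `|f j x| <= q.2 &
    forall x y d, box z q.1.1 x -> box z q.1.1 y -> (forall a, `|x 0 a - y 0 a| <= d) ->
      `|f j x - f j y| <= q.1.2 * d])
  (fun j => let: ex_intro r (ex_intro L (ex_intro B P)) := C1_lipschitz oW (Cf j) Wz in
     ex_intro _ (r, L, B) P).
have /nbhs_box[r0 r00 r0W] : nbhs z W by exact: open_nbhs_nbhs.
pose r := \big[Num.min/r0]_j (q j).1.1.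
pose L := \sum_j (q j).1.2; pose B := \sum_j `|(q j).2|.
have rle j : r <= (q j).1.1 by exact: bigmin_le_cond.
have sb s : r <= s -> box z r `<=` box z s.
  by move=> rs x bx a; exact: lt_le_trans (bx a) rs.
have L0 j : 0 <= (q j).1.2 by have [] := qP j.
exists r, L, B; split.
- by apply: lt_bigmin => // j _; have [] := qP j.
- exact: sumr_ge0.
- exact: sumr_ge0.
- apply: subset_trans r0W; apply: sb; exact: bigmin_le_id.
move=> j; have [_ _ _ b l] := qP j; split=> [x bx|x y d bx by_ xy].
  apply: (le_trans (b _ (sb _ (rle j) _ bx))); apply: (le_trans (ler_norm _)).
  by rewrite /B (bigD1 j)//= lerDl sumr_ge0.
apply: (le_trans (l x y d (sb _ (rle j) _ bx) (sb _ (rle j) _ by_) xy)).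
have d0 : 0 <= d by exact: le_trans (xy 0).
by rewrite ler_wpM2r// /L (bigD1 j)//= lerDl sumr_ge0.
Qed.

Lemma product_lipschitz (R : realFieldType) (a u a' u' d B K L : R) :
  `|a - a'| <= d -> `|u| <= B -> `|a'| <= K -> `|u - u'| <= L ->
  `|a * u - a' * u'| <= d * B + K * L.
Proof.
move=> h1 h2 h3 h4.
have -> : a * u - a' * u' = (a - a') * u + a' * (u - u') by ring.
by apply: (le_trans (ler_normD _ _)); rewrite !normrM lerD// ler_pM.
Qed.

Lemma geodesic_frame (K : comPzRingType) (E T : 'I_2 -> 'I_2 -> K)
    (dE dT G : 'I_2 -> 'I_2 -> 'I_2 -> K) (a v w : 'I_2 -> K) :
  (forall k j, \sum_m E m k * T m j = (k == j)%:R) ->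
  (forall m n, \sum_k T m k * E n k = (m == n)%:R) ->
  (forall b m n, \sum_k dT b m k * E n k = - \sum_k T m k * dE b n k) ->
  (forall k, v k = \sum_m a m * E m k) ->
  (forall k p q, G k p q = \sum_m E m k * dT p m q +
     \sum_m T m p * T m q * w m * E m k) ->
  forall k, \sum_m (a m * (\sum_b v b * dE b m k) + E m k * (- (a m ^+ 2 * w m)))
    + \sum_p \sum_q G k p q * v p * v q = 0.
Proof.
move=> ET TE dTE vE GE k.
have et j : E 0 k * T 0 j + E 1 k * T 1 j = (k == j)%:R by rewrite -ET sum2E.
have Tv m : T m 0 * v 0 + T m 1 * v 1 = a m.
  transitivity (a 0 * (\sum_k T m k * E 0 k) + a 1 * (\sum_k T m k * E 1 k)).
    by rewrite !vE !sum2E; ring.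
  by rewrite !TE; case: (ord2P m) => -> /=; ring.
have dTv b m : dT b m 0 * v 0 + dT b m 1 * v 1 =
    - (a 0 * (T m 0 * dE b 0 0 + T m 1 * dE b 0 1) +
       a 1 * (T m 0 * dE b 1 0 + T m 1 * dE b 1 1)).
  transitivity (a 0 * (\sum_k dT b m k * E 0 k) + a 1 * (\sum_k dT b m k * E 1 k)).
    by rewrite !vE !sum2E; ring.
  by rewrite !dTE !sum2E; ring.
have Gv : \sum_p \sum_q G k p q * v p * v q =
  \sum_p v p * (E 0 k * (dT p 0 0 * v 0 + dT p 0 1 * v 1) +
                E 1 k * (dT p 1 0 * v 0 + dT p 1 1 * v 1)) +
  (w 0 * E 0 k * (T 0 0 * v 0 + T 0 1 * v 1) ^+ 2 +
   w 1 * E 1 k * (T 1 0 * v 0 + T 1 1 * v 1) ^+ 2).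
  by rewrite !sum2E !GE !sum2E; ring.
rewrite Gv !Tv !sum2E !dTv.
transitivity (
  v 0 * (a 0 * dE 0 0 k + a 1 * dE 0 1 k
   - (a 0 * ((E 0 k * T 0 0 + E 1 k * T 1 0) * dE 0 0 0 + (E 0 k * T 0 1 + E 1 k * T 1 1) * dE 0 0 1)
    + a 1 * ((E 0 k * T 0 0 + E 1 k * T 1 0) * dE 0 1 0 + (E 0 k * T 0 1 + E 1 k * T 1 1) * dE 0 1 1)))
  + v 1 * (a 0 * dE 1 0 k + a 1 * dE 1 1 k
   - (a 0 * ((E 0 k * T 0 0 + E 1 k * T 1 0) * dE 1 0 0 + (E 0 k * T 0 1 + E 1 k * T 1 1) * dE 1 0 1)
    + a 1 * ((E 0 k * T 0 0 + E 1 k * T 1 0) * dE 1 1 0 + (E 0 k * T 0 1 + E 1 k * T 1 1) * dE 1 1 1)))).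
  by ring.
by rewrite !et; case: (ord2P k) => -> /=; ring.
Qed.

Section NullFrameField.
Variables (R : realType) (M : topologicalType) (S : oriented_surface R M).
Variables (g : lorentz_metric S) (V : 'I_2 -> chart S -> M -> 'rV[R]_2).
Variables (mu : M -> R) (H : conformal_null_frame g V mu).
Implicit Types (i j : chart S) (p : M).

Let W i : set 'rV[R]_2 := img i setT.
Let E i m k x : R := V m i (pnt i x) 0 k.

Let oW i : open (W i). Proof. by apply: open_img; exact: openT. Qed.

Let CE n i m k : Ck n (W i) (E i m k). Proof. exact: (cnf_smooth H). Qed.

Let Cmu n i : Ck n (W i) (fun x => mu (pnt i x)).
Proof. exact: (cnf_mu_smooth H). Qed.

Lemma pairingE (G : 'M[R]_2) (v w : 'rV[R]_2) :
  pairing G v w = \sum_a \sum_b v 0 a * G a b * w 0 b.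
Proof.
by rewrite /pairing mxE sum2E !mxE !sum2E; ring.
Qed.

Let gram i x m n : W i x ->
  \sum_a \sum_b E i m a x * g i (pnt i x) a b * E i n b x =
  (m != n)%:R * (- 2 * mu (pnt i x)).
Proof. by move=> /imgP[dx _ _]; rewrite -(cnf_gram H m n dx) pairingE. Qed.

Let commuting i x k : W i x ->
  \sum_a (E i 0 a x * pd a (E i 1 k) x - E i 1 a x * pd a (E i 0 k) x) = 0.
Proof.
by move=> /imgP[dx _ ex]; have := cnf_commute H dx k; rewrite ex.
Qed.

Let indep i x : W i x -> E i 0 0 x * E i 1 1 x - E i 0 1 x * E i 1 0 x != 0.
Proof.
move=> Wx; apply: (@null_gram_indep _ (fun m k => E i m k x)
  (fun a b => g i (pnt i x) a b) (- 2 * mu (pnt i x))).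
  by rewrite mulf_neq0 ?oppr_eq0 ?pnatr_eq0// gt_eqF// (cnf_mu_gt0 H).
by move=> m n; exact: gram.
Qed.

Lemma null_frame_conformally_flat : conformally_flat g.
Proof.
pose lam p := (mu p)^-1.
exists lam; split.
- move=> i n; apply: CkV; [exact: oW| |exact: Cmu].
  by move=> x _; rewrite gt_eqF// (cnf_mu_gt0 H).
- by move=> p; rewrite invr_gt0 (cnf_mu_gt0 H).
move=> i p dp l k a b.
have Wp : W i (crd i p) by exact: img_crd.
apply: (@riemann_frame_eq0 _ _ _ (fun i p => lam p *: g i p) i (W i) (E i)
  (fun=> - 2) (@oW i) _ _ _ _ _ _ _ _ _ _ _ Wp).
- by move=> m k'; exact: CE.
- by apply: Ck_cst; exact: oW.
- by move=> x _; rewrite oppr_eq0 pnatr_eq0.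
- by move=> x; exact: indep.
- by move=> x k'; exact: commuting.
- move=> x m n Wx.
  have mu0 : mu (pnt i x) != 0 by rewrite gt_eqF// (cnf_mu_gt0 H).
  transitivity (lam (pnt i x) * \sum_a \sum_b E i m a x * g i (pnt i x) a b * E i n b x).
    by rewrite !sum2E !mxE; ring.
  by rewrite gram// /lam; field.
- by move=> y c _; exact: pd_cst.
Qed.

(* V_m (log mu), which does not depend on the chosen chart. *)
Definition dlog_mu (m : 'I_2) p : R :=
  let i := sval (cid (dom_cover S p)) in
  (\sum_a V m i p 0 a * pd a (fun x => mu (pnt i x)) (crd i p)) / mu p.

Lemma dlog_muE m i p : dom i p -> dlog_mu m p =
  (\sum_a V m i p 0 a * pd a (fun x => mu (pnt i x)) (crd i p)) / mu p.
Proof.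
move=> di; rewrite /dlog_mu; case: cid => j /= dj; congr (_ / _).
have cc a : pd a (fun x => mu (pnt i x)) (crd i p) =
    \sum_(b < 2) jac i j p a b * pd b (fun x => mu (pnt j x)) (crd j p).
  exact: (@chart_change _ _ _ i j p setT mu a openT (@Cmu 1 j) di dj I).
under [RHS]eq_bigr do rewrite cc.
by rewrite (cnf_trans H m di dj) sum_mulmx.
Qed.

Lemma dlog_mu_Ck n i m : Ck n (W i) (fun x => dlog_mu m (pnt i x)).
Proof.
have C k : Ck n (W i) (fun x => E i m k x * pd k (fun x => mu (pnt i x)) x).
  by apply: CkM; [exact: oW|exact: CE|exact: (Ck_pd k (@Cmu n.+1 i))].
apply: (@Ck_ext _ _ _ (fun x => (E i m 0 x * pd 0 (fun x => mu (pnt i x)) x +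
    E i m 1 x * pd 1 (fun x => mu (pnt i x)) x) * (mu (pnt i x))^-1)).
- exact: oW.
- by move=> x /imgP[dx _ ex]; rewrite (dlog_muE _ dx) sum2E ex.
apply: CkM; [exact: oW|by apply: CkD => //; exact: oW|].
apply: CkV; [exact: oW| |exact: Cmu].
by move=> x _; rewrite gt_eqF// (cnf_mu_gt0 H).
Qed.

(* The geodesic equation in a commuting null frame: c' = a_0 V_0 + a_1 V_1 with
   a_m' = - a_m^2 V_m (log mu). *)
Definition null_flow (c : R -> M) (a : R -> 'I_2 -> R) (t : R) : Prop :=
  [/\ {for t, continuous c},
    forall i, dom i (c t) -> forall k, is_derive t 1 (fun s => crd i (c s) 0 k)
      (\sum_m a t m * V m i (c t) 0 k) &
    forall m, is_derive t 1 (fun s => a s m) (- (a t m ^+ 2 * dlog_mu m (c t)))].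

Lemma null_flow_chart i (c : R -> M) (a : R -> 'I_2 -> R) (t : R) : {for t, continuous c} -> dom i (c t) ->
  (forall k, is_derive t 1 (fun s => crd i (c s) 0 k)
     (\sum_m a t m * V m i (c t) 0 k)) ->
  (forall m, is_derive t 1 (fun s => a s m) (- (a t m ^+ 2 * dlog_mu m (c t)))) ->
  null_flow c a t.
Proof.
move=> ct di dc da; split=> // j dj k.
have C : Ck 1 (img i (dom j)) (fun x => crd j (pnt i x) 0 k) by exact: trans_smooth.
have D := @curve_chain _ _ _ i (dom j) (fun p => crd j p 0 k) c t _
  (dom_open j) C ct di dj dc.
rewrite (_ : \sum_m a t m * V m j (c t) 0 k =
  \sum_b (\sum_m a t m * V m i (c t) 0 b) *
    pd b (fun x => crd j (pnt i x) 0 k) (crd i (c t))) //.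
rewrite [LHS]sum2E (cnf_trans H 0 di dj) (cnf_trans H 1 di dj).
transitivity (\sum_b (\sum_m a t m * V m i (c t) 0 b) * jac i j (c t) b k).
  by move: (jac i j (c t)) => A; rewrite !sum2E !mxE !sum2E; ring.
by apply: eq_bigr => b _; rewrite [jac _ _ _ _ _]mxE.
Qed.

Lemma null_flow_near (c : R -> M) (a : R -> 'I_2 -> R) c' a' (t : R) :
  (\forall s \near t, c s = c' s /\ a s = a' s) -> null_flow c a t -> null_flow c' a' t.
Proof.
move=> n [cc dc da]; have [e1 e2] := nbhs_singleton n.
have n1 : \forall s \near t, c s = c' s by apply: filterS n => s [].
split.
- rewrite /prop_for /continuous_at -e1; apply: cvg_trans cc.
  exact: near_eq_cvg.
- move=> i; rewrite -e1 => di k; have := dc i di k.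
  rewrite -e2; apply: near_eq_is_derive; apply: filterS n1 => s ->.
  by [].
- move=> m; rewrite -e1 -e2; have := da m; apply: near_eq_is_derive.
  by apply: filterS n => s [_ ->].
Qed.

Lemma null_flow_shift (c : R -> M) (a : R -> 'I_2 -> R) (t u : R) : null_flow c a (t - u) ->
  null_flow (fun s => c (s - u)) (fun s => a (s - u)) t.
Proof.
have ds : is_derive t 1 (fun s : R => s - u) 1.
  rewrite -[X in is_derive _ _ _ X]subr0.
  exact: (is_deriveB (is_derive_id t 1) (is_derive_cst u t 1)).
move=> [cc dc da]; split.
- apply: (continuous_comp (f := fun s => s - u) (g := c)) => //.
  by apply: continuousB; [exact: cvg_id|exact: cst_continuous].
- move=> i di k.
  by have := @is_derive_comp1 _ _ (fun s => s - u) t _ _ (dc i di k) ds; rewrite mul1r.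
- by move=> m; have := @is_derive_comp1 _ _ (fun s => s - u) t _ _ (da m) ds; rewrite mul1r.
Qed.

Definition glue (T : Type) (u : R) (f h : R -> T) (s : R) : T :=
  if s <= u then f s else h s.

Lemma glue_continuous (T : topologicalType) (u : R) (f h : R -> T) : f u = h u ->
  {for u, continuous f} -> {for u, continuous h} -> {for u, continuous (glue u f h)}.
Proof.
move=> fh cf ch A; rewrite {1}/glue lexx => nA.
have n1 : \forall s \near u, A (f s) by exact: cf.
have n2 : \forall s \near u, A (h s) by apply: ch; rewrite -fh.
apply: (@filterS2 _ (nbhs u) _ _ _ _ _ n1 n2) => s /=.
by rewrite /glue; case: ifP.
Qed.

Lemma glue_is_derive (u d : R) (f h : R -> R) : f u = h u ->
  is_derive u 1 f d -> is_derive u 1 h d -> is_derive u 1 (glue u f h) d.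
Proof.
move=> fh [f1 f2] [h1 h2].
have lim : (fun k : R => k^-1 *: ((glue u f h \o shift u) (k *: (1 : R)) - glue u f h u))
    @ 0^' --> d.
  have lf : (fun k : R => k^-1 *: ((f \o shift u) (k *: (1 : R)) - f u)) @ 0^' --> d.
    by rewrite -f2; exact: f1.
  have lh : (fun k : R => k^-1 *: ((h \o shift u) (k *: (1 : R)) - h u)) @ 0^' --> d.
    by rewrite -h2; exact: h1.
  move=> A nA; apply: (@filterS2 _ (0 : R)^' _ _ _ _ _ (lf _ nA) (lh _ nA)) => k.
  by rewrite /= /glue lexx; case: ifP => _ //; rewrite fh.
split; first by apply/cvg_ex; exists d.
exact/cvg_lim.
Qed.

Lemma null_flow_glue u c a c' a' : c u = c' u -> a u = a' u ->
  null_flow c a u -> null_flow c' a' u -> null_flow (glue u c c') (glue u a a') u.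
Proof.
move=> ec ea [cc dc da] [cc' dc' da'].
have gc : glue u c c' u = c u by rewrite /glue lexx.
have ga : glue u a a' u = a u by rewrite /glue lexx.
split; first exact: glue_continuous.
- move=> i; rewrite gc ga => di k.
  have := glue_is_derive (f := fun s => crd i (c s) 0 k) (h := fun s => crd i (c' s) 0 k) _
    (dc i di k); rewrite ec ea => /(_ erefl (dc' i _ k)).
  rewrite -ec => /(_ di); congr is_derive.
  by apply/funext => s; rewrite /glue; case: ifP.
- move=> m; rewrite gc ga.
  have := glue_is_derive (f := a ^~ m) (h := a' ^~ m) _ (da m).
  rewrite ec ea => /(_ erefl (da' m)); congr is_derive.
  by apply/funext => s; rewrite /glue; case: ifP.
Qed.

Definition null_flow_on (l r : R) (c : R -> M) (a : R -> 'I_2 -> R) : Prop :=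
  forall t, l <= t <= r -> null_flow c a t.

Lemma null_flow_on_glue l u r c a c' a' : c u = c' u -> a u = a' u ->
  null_flow_on l u c a -> null_flow_on u r c' a' ->
  null_flow_on l r (glue u c c') (glue u a a').
Proof.
move=> ec ea F F' t /andP[lt tr].
have [tu|ut|tu] := ltgtP t u.
- apply: null_flow_near (F t _); last by rewrite lt ltW.
  by apply: filterS (cvgr_lt t (@cvg_id _ _) _ tu) => s /= /ltW su; rewrite /glue su.
- apply: null_flow_near (F' t _); last by rewrite tr ltW.
  apply: filterS (cvgr_gt t (@cvg_id _ _) _ ut) => s /= us.
  by rewrite /glue leNgt us.
- rewrite tu in lt tr *; apply: null_flow_glue => //.
    by apply: F; rewrite lt lexx.
  by apply: F'; rewrite tr lexx.
Qed.

Lemma mu_along c a t : null_flow c a t ->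
  is_derive t 1 (fun s => mu (c s)) (mu (c t) * \sum_m a t m * dlog_mu m (c t)).
Proof.
move=> [cc dc _]; have [i di] := dom_cover S (c t).
have D := @curve_chain _ _ _ i setT mu c t _ openT (@Cmu 1 i) cc di I (dc i di).
rewrite (_ : mu (c t) * _ = \sum_b (\sum_m a t m * V m i (c t) 0 b) *
  pd b (fun x => mu (pnt i x)) (crd i (c t))) //.
have m0 : mu (c t) != 0 by rewrite gt_eqF// (cnf_mu_gt0 H).
rewrite [in LHS]sum2E !(dlog_muE _ di) !sum2E.
move: (pd 0 _ _) (pd 1 _ _) => p q; field.
exact: m0.
Qed.

(* - g(c', c') / 4, which is conserved. *)
Definition energy (c : R -> M) (a : R -> 'I_2 -> R) (t : R) : R :=
  a t 0 * a t 1 * mu (c t).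

Lemma is_derive_const_on (f : R -> R) (l r : R) : l <= 0 <= r ->
  (forall t, l <= t <= r -> is_derive t 1 f 0) ->
  forall t, l <= t <= r -> f t = f 0.
Proof.
move=> /andP[l0 r0] df t /andP[lt tr].
have [|th _ E0] := @mvt_real R f (fun=> 0) t.
  move=> th /andP[t0 t1]; apply: df.
  have [tp|tn] := leP 0 t.
    rewrite (le_trans l0) ?mulr_ge0//= (le_trans _ tr)//.
    by rewrite ler_piMl.
  rewrite (le_trans lt) ?(le_trans _ r0)//=.
    by rewrite nmulr_lle0.
  by rewrite ler_niMl// ltW.
by apply/eqP; rewrite -subr_eq0 E0 mulr0.
Qed.

(* a_m mu is a multiple of g(c', V_(1-m)); as V_(1-m) is conformal, its derivative
   involves c' only through the conserved energy. *)
Lemma is_derive_momentum c a t m : null_flow c a t ->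
  is_derive t 1 (fun s => a s m * mu (c s))
    (energy c a t * dlog_mu (if m == 0 then 1 else 0) (c t)).
Proof.
move=> F; have [_ _ da] := F; have dm := mu_along F.
have D := is_deriveM (da m) dm.
rewrite (_ : energy c a t * _ = a t m *: (mu (c t) * \sum_m a t m * dlog_mu m (c t))
  + mu (c t) *: - (a t m ^+ 2 * dlog_mu m (c t))) //.
rewrite /energy sum2E -[_ *: _]/(_ * _) -[_ *: - _]/(_ * _).
by case: (ord2P m) => -> /=; ring.
Qed.

Lemma energy_const l r c a t : l <= 0 <= r -> null_flow_on l r c a ->
  l <= t <= r -> energy c a t = energy c a 0.
Proof.
move=> lr F; apply: is_derive_const_on lr _ t => t /F Ft.
have [_ _ da] := Ft.
have D := is_deriveM (da 0) (is_derive_momentum 1 Ft).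
rewrite (_ : energy c a = (a ^~ 0) * (fun s => a s 1 * mu (c s))); last first.
  by apply/funext => s; rewrite /energy -mulrA.
move: D; congr is_derive.
rewrite /energy /= -[_ *: _]/(_ * _) -[_ *: - _]/(_ * _); ring.
Qed.

Lemma flow_bound (l r T B m0 : R) c a t m : l <= 0 <= r -> null_flow_on l r c a ->
  (forall m p, `|dlog_mu m p| <= B) -> 0 < m0 -> (forall p, m0 <= mu p) ->
  l <= t <= r -> `|t| <= T ->
  `|a t m| <= (`|a 0 m * mu (c 0)| + T * (`|energy c a 0| * B)) / m0.
Proof.
move=> lr F wB m00 m0mu ltr tT; have mu0 := cnf_mu_gt0 H (c t).
rewrite ler_pdivlMr//; apply: (@le_trans _ _ `|a t m * mu (c t)|).
  by rewrite normrM (gtr0_norm mu0) ler_wpM2l.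
have seg th : 0 <= th <= 1 -> l <= th * t <= r.
  move=> /andP[t0 t1]; move: lr ltr => /andP[l0 r0] /andP[lt tr].
  have [tp|tn] := leP 0 t.
    rewrite (le_trans l0) ?mulr_ge0//= (le_trans _ tr)//.
    by rewrite ler_piMl.
  rewrite (le_trans lt) ?(le_trans _ r0)//=.
    by rewrite nmulr_lle0.
  by rewrite ler_niMl// ltW.
have [|th t01] := @mvt_real R (fun s => a s m * mu (c s))
  (fun s => energy c a s * dlog_mu (if m == 0 then 1 else 0) (c s)) t.
  by move=> th /seg/F; exact: is_derive_momentum.
rewrite (energy_const lr F (seg _ t01)) => /eqP.
rewrite subr_eq addrC => /eqP ->; apply: (le_trans (ler_normD _ _)).
by rewrite lerD2l normrM ler_pM// normrM ler_wpM2l.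
Qed.

Lemma local_flow (K : R) (p0 : M) : exists2 e : R, 0 < e &
  \forall p \near p0, forall b : 'I_2 -> R, (forall m, `|b m| <= K) ->
    exists c a, [/\ c 0 = p, a 0 = b & null_flow_on (- e) e c a].
Proof.
have [i di] := dom_cover S p0.
pose z := crd i p0; have Wz : W i z by exact: img_crd.
pose fam (ix : 'I_2 * 'I_2 + 'I_2) : 'rV[R]_2 -> R := match ix with
  | inl mk => E i mk.1 mk.2 | inr m => fun x => dlog_mu m (pnt i x) end.
have Cfam (ix : ('I_2 * 'I_2 + 'I_2)%type) : Ck 1 (W i) (fam ix).
  by case: ix => [[m k]|m]; [exact: CE|exact: dlog_mu_Ck].
have [r [L [B [r0 L0 B0 rW famP]]]] := C1_lipschitz_fam (@oW i) Cfam Wz.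
pose K' : R := `|K| + 1; have K0 : 0 <= K' by rewrite addr_ge0.
have r2 : 0 <= r / 2 by rewrite divr_ge0// ltW.
pose xof (y : 'I_2 + 'I_2 -> R) : 'rV[R]_2 :=
  \row_k (z 0 k + clamp (r / 2) (y (inl k) - z 0 k)).
pose aof (y : 'I_2 + 'I_2 -> R) m := clamp K' (y (inr m)).
have xof_box y : box z r (xof y).
  move=> k; rewrite mxE addrAC subrr add0r.
  by apply: le_lt_trans (clamp_le _ r2) _; rewrite ltr_pdivrMr// ltr_pMr// ltr1n.
have xof_lip (y y' : 'I_2 + 'I_2 -> R) (d : R) : (forall ix, `|y ix - y' ix| <= d) ->
    forall k, `|xof y 0 k - xof y' 0 k| <= d.
  move=> yy k; rewrite !mxE opprD addrACA subrr add0r.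
  apply: (le_trans (clamp_lipschitz _ _ r2)); rewrite opprB addrA subrK; exact: yy.
have aof_lip (y y' : 'I_2 + 'I_2 -> R) (d : R) : (forall ix, `|y ix - y' ix| <= d) ->
    forall m, `|aof y m - aof y' m| <= d.
  by move=> yy m; apply: (le_trans (clamp_lipschitz _ _ K0)); exact: yy.
have aofK y m : `|aof y m| <= K' by exact: clamp_le.
pose F (y : 'I_2 + 'I_2 -> R) (ix : 'I_2 + 'I_2) : R := match ix with
  | inl k => \sum_m aof y m * E i m k (xof y)
  | inr m => - (aof y m ^+ 2 * dlog_mu m (pnt i (xof y))) end.
pose BF := (K' * B) *+ 2 + K' * (K' * B).
pose LF := (B + K' * L) *+ 2 + (K' * (B + K' * L) + K' * B).
have KB : 0 <= K' * B by exact: mulr_ge0.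
have BL : 0 <= B + K' * L by rewrite addr_ge0// mulr_ge0.
have BF0 : 0 <= BF by rewrite addr_ge0 ?mulrn_wge0// mulr_ge0.
have LF0 : 0 <= LF by rewrite addr_ge0 ?mulrn_wge0// addr_ge0// mulr_ge0.
have EB m k y : `|E i m k (xof y)| <= B.
  by have [h _] := famP (inl (m, k)); exact: h.
have wB m y : `|dlog_mu m (pnt i (xof y))| <= B.
  by have [h _] := famP (inr m); exact: h.
have FB y (ix : ('I_2 + 'I_2)%type) : `|F y ix| <= BF.
  case: ix => [k|m] /=.
    rewrite sum2E; apply: (le_trans (ler_normD _ _)).
    rewrite -[leLHS]addr0 lerD ?mulr_ge0// mulr2n lerD// normrM ler_pM//.
  rewrite normrN -[leLHS]add0r lerD ?mulrn_wge0// expr2 -mulrA !(normrM (aof y m)).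
  by rewrite ler_pM// ?mulr_ge0// ler_pM.
have FL y y' (d : R) : (forall ix, `|y ix - y' ix| <= d) ->
    forall ix, `|F y ix - F y' ix| <= LF * d.
  move=> yy ix.
  have d0 : 0 <= d by exact: le_trans (yy (inl 0)).
  have hx := xof_lip _ _ _ yy; have ha := aof_lip _ _ _ yy.
  have hE m k : `|aof y m * E i m k (xof y) - aof y' m * E i m k (xof y')| <=
      (B + K' * L) * d.
    rewrite mulrDl [B * d]mulrC -mulrA; apply: product_lipschitz => //.
    by have [_ h] := famP (inl (m, k)); exact: h.
  have hw m : `|aof y m * dlog_mu m (pnt i (xof y)) -
      aof y' m * dlog_mu m (pnt i (xof y'))| <= (B + K' * L) * d.
    rewrite mulrDl [B * d]mulrC -mulrA; apply: product_lipschitz => //.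
    by have [_ h] := famP (inr m); exact: h.
  case: ix => [k|m] /=.
    rewrite !sum2E opprD addrACA; apply: (le_trans (ler_normD _ _)).
    rewrite -[leLHS]addr0 /LF mulrDl lerD//.
      by rewrite mulr2n mulrDl lerD.
    by rewrite mulr_ge0// addr_ge0// mulr_ge0.
  rewrite -opprD normrN -[leLHS]add0r /LF mulrDl lerD//.
    by rewrite mulr_ge0// mulrn_wge0.
  rewrite -mulNr !expr2 mulNr -!mulrA.
  have -> : (K' * (B + K' * L) + K' * B) * d = d * (K' * B) + K' * ((B + K' * L) * d).
    by ring.
  apply: product_lipschitz => //.
  by rewrite normrM ler_pM.
pose q := 1 + LF + BF.
have q0 : 0 < q by rewrite /q -addrA ltr_pwDl// addr_ge0.
pose s := Num.min 2^-1 (r / 4).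
have s0 : 0 < s by rewrite /s lt_min invr_gt0 ltr0n divr_gt0.
pose e := s / q.
have e0 : 0 < e by rewrite divr_gt0.
have eL : e * LF <= 2^-1.
  rewrite /e mulrAC ler_pdivrMr//.
  have h : s <= 2^-1 by rewrite ge_min lexx.
  by apply: (le_trans (ler_wpM2r LF0 h)); rewrite ler_pM2l// /q; lra.
have eB : BF * e <= s.
  rewrite /e mulrA ler_pdivrMr// mulrC ler_pM2l// /q; lra.
exists (e / 2); first by rewrite divr_gt0.
have nd := near_dom di.
have r4 : 0 < r / 4 by rewrite divr_gt0.
have nz : \forall p \near p0, box z (r / 4) (crd i p).
  by apply: (crd_cont di); apply/nbhs_box; exists (r / 4).
apply: filterS2 nd nz => p dp bp b bK.
pose y0 (ix : 'I_2 + 'I_2) := match ix with inl k => crd i p 0 k | inr m => b m end.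
have [y [yy0 yB yD]] := picard_lindelof FB FL y0 BF0 LF0 e0 eL.
pose x t : 'rV[R]_2 := \row_k y t (inl k).
have ys t (ix : ('I_2 + 'I_2)%type) : `|y t ix - y0 ix| <= s by exact: le_trans (yB t ix) eB.
have xE (t : R) : xof (y t) = x t.
  apply/rowP => k; rewrite !mxE clampE; first by rewrite addrC subrK.
  have h1 := ys t (inl k).
  have h2 := bp k.
  have h3 : s <= r / 4 by rewrite ge_min lexx orbT.
  have := ler_distD (crd i p 0 k) (y t (inl k)) (z 0 k).
  rewrite /= in h1; move: h1 h2 h3; move: (`|_|) (`|_|) (`|_|) => *; lra.
have aE (t : R) m : aof (y t) m = y t (inr m).
  rewrite /aof clampE//; have h1 := ys t (inr m); rewrite /= in h1.
  have h2 : s <= 2^-1 by rewrite ge_min lexx.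
  have := ler_distD 0 (y t (inr m)) (b m); rewrite !subr0.
  have h3 : `|y t (inr m)| <= `|y t (inr m) - b m| + `|b m|.
    by rewrite -[X in `|X| <= _](subrK (b m)); exact: ler_normD.
  have h4 := bK m; have h5 := ler_norm K.
  rewrite /K'; move: h1 h2 h3 h4 h5; move: (`|_|) (`|_|) (`|_|) (`|_|) => *; lra.
have Wx t : W i (x t) by apply: rW; rewrite -xE; exact: xof_box.
have xx : x 0 = crd i p by apply/rowP => k; rewrite mxE yy0.
exists (fun t => pnt i (x t)), (fun t m => y t (inr m)); split.
- by rewrite xx crdK.
- by apply/funext => m; rewrite yy0.
move=> t; rewrite -ler_norml => te.
have {}te : `|t| < e by apply: le_lt_trans te _; rewrite ltr_pdivrMr// ltr_pMr// ltr1n.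
have [dx _ cx] := imgP (Wx t).
have dxk (k : 'I_2) : is_derive t 1 (fun s => x s 0 k) (\sum_m y t (inr m) * V m i (pnt i (x t)) 0 k).
  have := yD t (inl k) te; rewrite /= xE !sum2E !aE; congr is_derive.
  by apply/funext => u; rewrite mxE.
apply: (@null_flow_chart i) => //.
- apply: (continuous_comp (f := x) (g := pnt i)); last first.
    by apply: pnt_cont; have [q' [dq _] qx] := Wx t; exists q'.
  apply: cvg_rV2 => k; have [+ _] := dxk k.
  by move=> /derivable1_diffP/differentiable_continuous.
- move=> k; have := dxk k; congr is_derive; apply/funext => u.
  by have [_ _ ->] := imgP (Wx u).
- by move=> m; have := yD t (inr m) te; rewrite /= aE xE.
Qed.

Lemma continuous_of_charts (f : M -> R) :
  (forall i, Ck 0 (W i) (fun x => f (pnt i x))) -> continuous f.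
Proof.
move=> Cf p; have [i di] := dom_cover S p.
have n : \forall q \near p, f (pnt i (crd i q)) = f q.
  by apply: filterS (near_dom di) => q dq; rewrite crdK.
rewrite /continuous_at -(nbhs_singleton n); apply: cvg_trans (near_eq_cvg n) _.
apply: (continuous_comp (f := crd i) (g := fun x => f (pnt i x))).
  exact: crd_cont.
by apply: (Ck_continuous (Cf i)); exact: img_crd.
Qed.

Lemma compact_bound (f : M -> R) : compact [set: M] -> continuous f ->
  exists B, forall p, `|f p| <= B.
Proof.
move=> /compact_near_coveringP cM cf.
have := cM R (pinfty_nbhs R) (fun B p => `|f p| <= B) _.
case=> [p _|B [_ HB]].
  have n : \forall q \near p, `|f q| < `|f p| + 1.
    have /cvgrPdist_lt/(_ _ ltr01) := cf p; apply: filterS => q h.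
    rewrite -[f q](subrKC (f p)) (le_lt_trans (ler_normD _ _))// ltrD2l.
    by rewrite distrC.
  exists ([set q | `|f q| < `|f p| + 1], [set B | `|f p| + 1 < B]) => /=.
    by split=> //; exists (`|f p| + 1); split=> //; exact: num_real.
  by move=> [q B] /= [h1 h2]; apply: ltW; exact: lt_trans h2.
exists (B + 1) => p; apply: HB => //=.
by rewrite ltrDl.
Qed.

Lemma uniform_flow (K : R) : compact [set: M] -> exists2 e : R, 0 < e &
  forall p (b : 'I_2 -> R), (forall m, `|b m| <= K) ->
    exists c a, [/\ c 0 = p, a 0 = b & null_flow_on (- e) e c a].
Proof.
move=> /compact_near_coveringP cM.
have [p _|e [e0 He]] := cM R (0 : R)^'+ (fun e p => forall b : 'I_2 -> R,
  (forall m, `|b m| <= K) ->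
    exists c a, [/\ c 0 = p, a 0 = b & null_flow_on (- e) e c a]) _.
  have [e e0 n] := local_flow K p.
  exists ([set q | forall b : 'I_2 -> R, (forall m, `|b m| <= K) ->
    exists c a, [/\ c 0 = q, a 0 = b & null_flow_on (- e) e c a]], [set e' | e' < e]) => /=.
    by split=> //; exact: nbhs_right_lt.
  move=> [q e'] /= [h1 h2] b bK; have [c [a [c0 a0 F]]] := h1 b bK.
  exists c, a; split=> // t /andP[t1 t2]; apply: F.
  rewrite (le_trans _ t1) ?(le_trans t2) ?ltW//.
  by rewrite ltrN2.
have e2 : 0 < e / 2 by rewrite divr_gt0.
exists (e / 2) => // p; apply: (He (e / 2)) => //=.
by rewrite sub0r normrN gtr0_norm// ltr_pdivrMr// ltr_pMr// ltr1n.
Qed.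

Lemma glueL (T : Type) (u s : R) (f h : R -> T) : s <= u -> glue u f h s = f s.
Proof. by rewrite /glue => ->. Qed.

Lemma glueR (T : Type) (u s : R) (f h : R -> T) : f u = h u -> u <= s ->
  glue u f h s = h s.
Proof.
by rewrite /glue le_eqVlt => fh /orP[/eqP <-|us]; rewrite ?lexx// leNgt us.
Qed.

Lemma extend_flow (T : R) c a : compact [set: M] -> 0 <= T ->
  null_flow_on (- T) T c a ->
  exists c' a', null_flow_on (- (T + 1)) (T + 1) c' a' /\
    forall t, `|t| <= T -> c' t = c t /\ a' t = a t.
Proof.
move=> cM T0 F.
have [B0 HB0] := compact_bound cM (continuous_of_charts (fun i => dlog_mu_Ck 0 i 0)).
have [B1 HB1] := compact_bound cM (continuous_of_charts (fun i => dlog_mu_Ck 0 i 1)).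
have wB m p : `|dlog_mu m p| <= Num.max B0 B1.
  by case: (ord2P m) => ->; rewrite le_max ?HB0 ?HB1 ?orbT.
have [B2 HB2] : exists B, forall p, `|(mu p)^-1| <= B.
  apply: compact_bound cM _; apply: continuous_of_charts => i.
  apply: CkV; [exact: oW| |exact: Cmu].
  by move=> x _; rewrite gt_eqF// (cnf_mu_gt0 H).
pose m0 := (`|B2| + 1)^-1.
have m00 : 0 < m0 by rewrite invr_gt0 ltr_wpDl.
have m0mu p : m0 <= mu p.
  have mu0 := cnf_mu_gt0 H p.
  rewrite /m0 invf_ple ?posrE ?ltr_wpDl//.
  apply: le_trans (ler_norm _) _; apply: le_trans (HB2 p) _.
  by apply: le_trans (ler_norm _) _; rewrite lerDl.
pose K := \sum_m (`|a 0 m * mu (c 0)| + (T + 1) * (`|energy c a 0| * Num.max B0 B1)) / m0.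
have T1 : 0 <= T + 1 by rewrite addr_ge0.
have Bge0 : 0 <= Num.max B0 B1 by exact: le_trans (wB 0 (c 0)).
have bound T' c' a' t m : 0 <= T' <= T + 1 -> null_flow_on (- T') T' c' a' ->
    (forall t, `|t| <= T -> c' t = c t /\ a' t = a t) -> `|t| <= T' -> `|a' t m| <= K.
  move=> /andP[T'0 T'1] F' ag tT'.
  have [c'0 a'0] : c' 0 = c 0 /\ a' 0 = a 0 by apply: ag; rewrite normr0.
  have := @flow_bound (- T') T' (T + 1) (Num.max B0 B1) m0 c' a' t m _ F' wB m00 m0mu.
  rewrite oppr_le0 T'0 -ler_norml => /(_ isT tT' (le_trans tT' T'1)).
  rewrite /energy c'0 a'0 => h; apply: (le_trans h).
  rewrite /K (bigD1 m)//= lerDl; apply: sumr_ge0 => n _.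
  by apply: divr_ge0 (ltW m00); rewrite addr_ge0// mulr_ge0// mulr_ge0.
have [e e0 He] := uniform_flow K cM.
pose N := (Num.truncn e^-1).+1; pose d : R := N%:R^-1.
have N0 : 0 < N%:R :> R by rewrite ltr0n.
have d0 : 0 < d by rewrite invr_gt0.
have de : d <= e.
  by rewrite /d invf_ple ?posrE//; apply: ltW; exact: truncnS_gt.
suff step k : (k <= N)%N -> exists c' a',
    null_flow_on (- (T + k%:R * d)) (T + k%:R * d) c' a' /\
    forall t, `|t| <= T -> c' t = c t /\ a' t = a t.
  have [c' [a' [F' ag]]] := step N (leqnn _); exists c', a'; split=> //.
  by move: F'; rewrite /d divff// gt_eqF.
elim: k => [|k IH] kN; first by exists c, a; rewrite mul0r addr0.
have [c' [a' [F' ag]]] := IH (ltnW kN).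
pose T' := T + k%:R * d; rewrite -/T' in F'.
have kd : k%:R * d <= 1.
  by rewrite /d ler_pdivrMr// mul1r ler_nat ltnW.
have T'0 : 0 <= T' by rewrite addr_ge0// mulr_ge0// ltW.
have T'1 : T' <= T + 1 by rewrite lerD2l.
have TT' : T <= T' by rewrite lerDl mulr_ge0// ltW.
have -> : T + k.+1%:R * d = T' + d by rewrite /T' -natr1; ring.
have bT m : `|a' T' m| <= K.
  by apply: (bound T' _ _ _ _ _ F' ag); rewrite ?T'0// ger0_norm.
have bN m : `|a' (- T') m| <= K.
  by apply: (bound T' _ _ _ _ _ F' ag); rewrite ?T'0// normrN ger0_norm.
have [cr [ar [cr0 ar0 Fr]]] := He (c' T') (a' T') bT.
have [cl [al [cl0 al0 Fl]]] := He (c' (- T')) (a' (- T')) bN.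
pose cr' s := cr (s - T'); pose ar' s := ar (s - T').
pose cl' s := cl (s - - T'); pose al' s := al (s - - T').
have ecr : c' T' = cr' T' by rewrite /cr' subrr cr0.
have ear : a' T' = ar' T' by rewrite /ar' subrr ar0.
have T'N : - T' <= T' by rewrite -subr_ge0 opprK addr_ge0.
have Fr' : null_flow_on T' (T' + d) cr' ar'.
  move=> t /andP[t1 t2]; apply: null_flow_shift; apply: Fr.
  have : t - T' <= d by rewrite lerBlDl.
  have : 0 <= t - T' by rewrite subr_ge0.
  move: (t - T') => s; lra.
have Fl' : null_flow_on (- (T' + d)) (- T') cl' al'.
  move=> t /andP[t1 t2]; apply: null_flow_shift; apply: Fl.
  have : t - - T' <= 0 by rewrite subr_le0.
  have : - d <= t - - T' by rewrite lerBrDl -opprD.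
  move: (t - - T') => s; lra.
have F1 := null_flow_on_glue ecr ear F' Fr'.
have ecl : cl' (- T') = glue T' c' cr' (- T') by rewrite glueL// /cl' subrr cl0.
have eal : al' (- T') = glue T' a' ar' (- T') by rewrite glueL// /al' subrr al0.
have F2 := null_flow_on_glue ecl eal Fl' F1.
exists (glue (- T') cl' (glue T' c' cr')), (glue (- T') al' (glue T' a' ar')).
split=> // t tT; have := tT; rewrite ler_norml => /andP[t1 t2].
have t3 : t <= T' by exact: le_trans TT'.
have t4 : - T' <= t by apply: le_trans t1; rewrite lerN2.
by rewrite (glueR ecl t4) (glueR eal t4) !glueL//; exact: ag.
Qed.

Lemma global_flow p (b : 'I_2 -> R) : compact [set: M] ->
  exists c a, [/\ c 0 = p, a 0 = b & forall t, null_flow c a t].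
Proof.
move=> cM.
have [K bK] : exists K, forall m, `|b m| <= K.
  exists (`|b 0| + `|b 1|) => m.
  by case: (ord2P m) => ->; rewrite ?lerDl ?lerDr.
have [e e0 n0] := local_flow K p.
have [c0 [a0 [c00 a00 F0]]] := nbhs_singleton n0 b bK.
have [ext extP] := @choice _ _
  (fun (z : nat * ((R -> M) * (R -> 'I_2 -> R))) (z' : (R -> M) * (R -> 'I_2 -> R)) =>
    null_flow_on (- z.1%:R) z.1%:R z.2.1 z.2.2 ->
    null_flow_on (- z.1.+1%:R) z.1.+1%:R z'.1 z'.2 /\
    forall t, `|t| <= z.1%:R -> z'.1 t = z.2.1 t /\ z'.2 t = z.2.2 t)
  ltac:(move=> [n [c a]] /=; have [F|nF] := pselect (null_flow_on (- n%:R) n%:R c a);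
    [have [c' [a' [F' ag]]] := extend_flow cM (ler0n _ _) F;
     exists (c', a') => _ /=; rewrite -natr1; split; [exact: F'|exact: ag]
    |by exists (c, a)]).
pose X := fix X n := if n is n'.+1 then ext (n', X n') else (c0, a0).
have FX n : null_flow_on (- n%:R) n%:R (X n).1 (X n).2.
  elim: n => [|n IH]; last exact: (extP (n, X n) IH).1.
  by move=> t /andP[t1 t2]; apply: F0; apply/andP; split; lra.
have agS n t : `|t| <= n%:R -> (X n.+1).1 t = (X n).1 t /\ (X n.+1).2 t = (X n).2 t.
  exact: (extP (n, X n) (FX n)).2.
have ag n k t : `|t| <= n%:R ->
    (X (n + k)%N).1 t = (X n).1 t /\ (X (n + k)%N).2 t = (X n).2 t.
  move=> tn; elim: k => [|k [IH1 IH2]]; first by rewrite addn0.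
  rewrite addnS; have [|-> ->] := agS (n + k)%N t; last by [].
  by apply: (le_trans tn); rewrite ler_nat leq_addr.
pose idx (t : R) := (Num.truncn `|t|).+1.
have idxP (t : R) : `|t| < (idx t)%:R by exact: truncnS_gt.
have [e1 e2] : (X 1%N).1 0 = c0 0 /\ (X 1%N).2 0 = a0 0 by apply: (agS 0%N); rewrite normr0.
exists (fun t => (X (idx t)).1 t), (fun t => (X (idx t)).2 t); split.
- by rewrite /idx normr0 truncn0 e1.
- by rewrite /idx normr0 truncn0 e2.
move=> t; pose N := idx t.
have n1 : \forall s \near t, `|s| < N%:R.
  have /cvgr_lt/(_ _ (idxP t)) : `|s| @[s --> t] --> `|t| by exact: norm_continuous.
  by [].
apply: (@null_flow_near (X N).1 (X N).2).
  apply: filterS n1 => s sN.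
  have le : (idx s <= N)%N.
    by rewrite /idx -(ltr_nat R); apply: le_lt_trans sN; rewrite truncn_le.
  have [e3 e4] := ag (idx s) (N - idx s)%N s (ltW (idxP s)).
  by rewrite subnKC// in e3 e4.
by apply: FX; rewrite -ler_norml ltW.
Qed.

Lemma flow_geodesic c a : (forall t, null_flow c a t) -> geodesic g c.
Proof.
move=> F; split=> [t|i t dt x k]; first by have [] := F t.
have dx s : dom i (c s) -> forall k,
    is_derive s 1 (x k) (\sum_m a s m * V m i (c s) 0 k).
  by move=> ds k'; have [_ h _] := F s; exact: h.
have n : \forall s \near t, dom i (c s).
  by have [ct _ _] := F t; apply: ct; exact: near_dom.
have dE s : dom i (c s) -> forall k, (x k)^`()%classic s = \sum_m a s m * V m i (c s) 0 k.
  by move=> ds k'; have [_ <-] := dx s ds k'; rewrite derive1E.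
pose v b := \sum_m a t m * V m i (c t) 0 b.
have [ct _ da] := F t.
have d2 m : is_derive t 1 (fun s => a s m * V m i (c s) 0 k)
    (a t m * (\sum_b v b * pd b (E i m k) (crd i (c t)))
     + E i m k (crd i (c t)) * - (a t m ^+ 2 * dlog_mu m (c t))).
  have D := @curve_chain _ _ _ i setT (fun p => V m i p 0 k) c t v openT
    (@CE 1 i m k) ct dt I (dx t dt).
  by have := is_deriveM (da m) D; rewrite /E crdK.
have d2s : is_derive t 1 (fun s => \sum_m a s m * V m i (c s) 0 k)
    (\sum_m (a t m * (\sum_b v b * pd b (E i m k) (crd i (c t)))
     + E i m k (crd i (c t)) * - (a t m ^+ 2 * dlog_mu m (c t)))).
  rewrite [X in is_derive _ _ _ X]sum2E.
  have := is_deriveD (d2 0) (d2 1); congr is_derive.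
  by apply/funext => s; rewrite sum2E.
have D2 : is_derive t 1 ((x k)^`()%classic) (\sum_m (a t m * (\sum_b v b * pd b (E i m k) (crd i (c t)))
     + E i m k (crd i (c t)) * - (a t m ^+ 2 * dlog_mu m (c t)))).
  apply: near_eq_is_derive d2s; apply: filterS n => s ds.
  by rewrite dE.
split; [by have [] := dx t dt k|by case: D2|].
rewrite derive1E; have [_ ->] := D2.
under [X in _ + X]eq_bigr do under eq_bigr do rewrite !(dE t dt) -!/(v _).
set y := crd i (c t).
have Wy : W i y by exact: img_crd.
pose T m b := dual_frame (fun m k => E i m k y) m b.
apply: (@geodesic_frame _ (fun m k => E i m k y) T (fun b m k => pd b (E i m k) y)
  (fun b m k => pd b (fun x => dual_frame (fun m k => E i m k x) m k) y)
  (fun k a b => christoffel g i k a b y) (a t) v (fun m => dlog_mu m (c t)) _ _ _ _ _ k).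
- by move=> k' j; exact: (@frame_dualK _ (fun m k => E i m k y) _ _ (indep Wy)).
- by move=> m n'; exact: (@dual_frameK _ (fun m k => E i m k y) _ _ (indep Wy)).
- move=> b m n'.
  exact: (@pd_dual_frame _ (W i) (E i) (@oW i) (@CE 2 i) (@indep i) y b m n' Wy).
- by move=> k'; rewrite /v /E /y crdK.
- move=> k' a' b'.
  have Cf : Ck 1 (W i) (fun x => - 2 * mu (pnt i x)).
    by apply: CkM; [exact: oW|apply: Ck_cst; exact: oW|exact: Cmu].
  have f0 z : W i z -> - 2 * mu (pnt i z) != 0.
    by move=> _; rewrite mulf_neq0 ?oppr_eq0 ?pnatr_eq0// gt_eqF// (cnf_mu_gt0 H).
  rewrite (@christoffel_frame _ _ _ g i (W i) (E i) _ (@oW i) (@CE 2 i) Cf f0 (@indep i)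
    (@commuting i) (@gram i) _ _ _ _ Wy); congr (_ + _).
  apply: eq_bigr => m _; congr (_ * _ * _).
  have dmu c' : derivable (fun x => mu (pnt i x)) y (delta_mx 0 c').
    exact: Ck_derivable (@Cmu 1 i) Wy.
  rewrite (dlog_muE _ dt) !sum2E !(pdZ _ (dmu _)) /E /y crdK//.
  have m0 : mu (c t) != 0 by rewrite gt_eqF// (cnf_mu_gt0 H).
  move: (pd 0 _ _) (pd 1 _ _) => u1 u2; field.
  exact: m0.
Qed.

Lemma null_frame_complete : compact [set: M] -> geodesically_complete g.
Proof.
move=> cM _ i p v dp.
have Wp : W i (crd i p) by exact: img_crd.
pose b m := \sum_k v 0 k * dual_frame (fun m k => E i m k (crd i p)) m k.
have [c [a [c0 a0 F]]] := global_flow p b cM.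
exists c; split=> //; first exact: flow_geodesic F.
move=> k; have [_ dc _] := F 0; rewrite c0 in dc.
have [_ dk] := dc i dp k; rewrite derive1E dk a0 /b.
transitivity (\sum_j v 0 j * \sum_m E i m k (crd i p) * dual_frame (fun m k => E i m k (crd i p)) m j).
  rewrite !sum2E /E crdK//; ring.
rewrite sum2E !(@frame_dualK _ (fun m k => E i m k (crd i p)) _ _ (indep Wp)).
by case: (ord2P k) => -> /=; ring.
Qed.

End NullFrameField.

(** * The null frame of a pair of twistor spinors *)

Section ConnectionAlgebra.
Variable K : fieldType.
Implicit Types (F G Ginv : 'I_2 -> 'I_2 -> K) (dG C dF : 'I_2 -> 'I_2 -> 'I_2 -> K).

Lemma christoffel_compat G Ginv dG C : (2 : K) != 0 ->
  (forall a b, G a b = G b a) -> (forall c a b, dG c a b = dG c b a) ->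
  (forall l m, \sum_k G l k * Ginv k m = (l == m)%:R) ->
  (forall k a b, C k a b =
     2^-1 * \sum_l Ginv k l * (dG a l b + dG b l a - dG l a b)) ->
  (forall k a b, C k a b = C k b a) /\
  forall c a b, dG c a b = \sum_d (C d c a * G d b) + \sum_d (C d c b * G a d).
Proof.
move=> two Gs dGs inv CE; split=> [k a b|c a b].
  by rewrite !CE !sum2E (dGs 0 b a) (dGs 1 b a); ring.
have i2 l m : G l 0 * Ginv 0 m + G l 1 * Ginv 1 m = (l == m)%:R.
  by rewrite -inv sum2E.
have low l p q : \sum_d C d p q * G l d = 2^-1 * (dG p l q + dG q l p - dG l p q).
  transitivity (2^-1 * \sum_m (G l 0 * Ginv 0 m + G l 1 * Ginv 1 m) *
      (dG p m q + dG q m p - dG m p q)).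
    by rewrite sum2E !CE !sum2E; ring.
  by rewrite sum2E !i2; case: (ord2P l) => -> /=; ring.
rewrite low; under eq_bigr do rewrite (Gs _ b).
rewrite low (dGs c b a) (dGs a b c) (dGs b a c); field.
exact: two.
Qed.

Definition mink2 (r q : 'I_2) : K := if r == q then (if r == 0 then -1 else 1) else 0.

(* [tau r] is the value g(nabla_(s_r) s_1, s_2) of the connection form. *)
Lemma frame_bracket F G dG C dF (tau : 'I_2 -> K) : (2 : K) != 0 ->
  (forall a b, G a b = G b a) ->
  (forall k a b, C k a b = C k b a) ->
  (forall c a b, dG c a b = \sum_d (C d c a * G d b) + \sum_d (C d c b * G a d)) ->
  (forall r q, \sum_a \sum_b F r a * G a b * F q b = mink2 r q) ->
  (forall c r q, \sum_a \sum_b (dF c r a * G a b * F q b + F r a * dG c a b * F q b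
      + F r a * G a b * dF c q b) = 0) ->
  (forall r, tau r = \sum_a \sum_b
     (\sum_c F r c * (dF c 0 a + \sum_d C a c d * F 0 d)) * G a b * F 1 b) ->
  forall k, \sum_a (F 0 a * dF a 1 k - F 1 a * dF a 0 k) =
    tau 0 * F 0 k - tau 1 * F 1 k.
Proof.
move=> two Gs Cs dGE orth dorth tauE.
pose D c r k := dF c r k + \sum_d C k c d * F r d.
pose P c r q := \sum_a \sum_b D c r a * G a b * F q b.
have skew c r q : P c r q = - P c q r.
  apply/eqP; rewrite -subr_eq0 opprK; apply/eqP.
  rewrite -[RHS](dorth c r q) /P /D !sum2E !dGE !sum2E (Gs 1 0); ring.
have P0 c r : P c r r = 0.
  have /eqP := skew c r r; rewrite -subr_eq0 opprK -mulr2n -mulr_natl mulf_eq0.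
  by rewrite (negbTE two) => /eqP.
have tP r : tau r = \sum_c F r c * P c 0 1.
  by rewrite tauE /P /D !sum2E; ring.
pose z k := \sum_a (F 0 a * dF a 1 k - F 1 a * dF a 0 k) - (tau 0 * F 0 k - tau 1 * F 1 k).
have zP q : \sum_k \sum_b z k * G k b * F q b = 0.
  transitivity (\sum_a (F 0 a * P a 1 q - F 1 a * P a 0 q)
     - (tau 0 * (\sum_a \sum_b F 0 a * G a b * F q b)
     - tau 1 * (\sum_a \sum_b F 1 a * G a b * F q b))).
    rewrite /z /P /D !sum2E (Cs 0 1 0) (Cs 1 1 0); ring.
  rewrite !orth !tP !sum2E; case: (ord2P q) => -> /=; rewrite /mink2 /=.
    by rewrite !P0 !(skew _ 1 0); ring.
  by rewrite !P0; ring.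
have Gz b : \sum_k z k * G k b = 0.
  have o r q : F r 0 * G 0 0 * F q 0 + F r 0 * G 0 1 * F q 1 +
    (F r 1 * G 1 0 * F q 0 + F r 1 * G 1 1 * F q 1) = mink2 r q by rewrite -orth !sum2E.
  pose dF' := F 0 0 * F 1 1 - F 0 1 * F 1 0.
  have d0 : dF' != 0.
    apply/eqP => e.
    have : dF' ^+ 2 * (G 0 0 * G 1 1 - G 0 1 * G 1 0) =
       mink2 0 0 * mink2 1 1 - mink2 0 1 * mink2 1 0 by rewrite -!o /dF'; ring.
    by rewrite e expr0n /= mul0r /mink2 /= => /eqP; rewrite mulr1 mulr0 subr0 eq_sym oppr_eq0 oner_eq0.
  have z0 := zP 0; have z1 := zP 1.
  apply: (mulIf d0); rewrite mul0r.
  case: (ord2P b) => ->.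
    transitivity (F 1 1 * (\sum_k \sum_b z k * G k b * F 0 b) -
                  F 0 1 * (\sum_k \sum_b z k * G k b * F 1 b)).
      by rewrite /dF' !sum2E; ring.
    by rewrite z0 z1; ring.
  transitivity (F 0 0 * (\sum_k \sum_b z k * G k b * F 1 b) -
                F 1 0 * (\sum_k \sum_b z k * G k b * F 0 b)).
    by rewrite /dF' !sum2E; ring.
  by rewrite z0 z1; ring.
move=> k; apply/eqP; rewrite -subr_eq0 -/(z k); apply/eqP.
have o r q : F r 0 * G 0 0 * F q 0 + F r 0 * G 0 1 * F q 1 +
    (F r 1 * G 1 0 * F q 0 + F r 1 * G 1 1 * F q 1) = mink2 r q by rewrite -orth !sum2E.
pose dG' := G 0 0 * G 1 1 - G 0 1 * G 1 0.
have d0 : dG' != 0.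
  apply/eqP => e.
  have : (F 0 0 * F 1 1 - F 0 1 * F 1 0) ^+ 2 * dG' =
     mink2 0 0 * mink2 1 1 - mink2 0 1 * mink2 1 0 by rewrite -!o /dG'; ring.
  by rewrite e mulr0 /mink2 /= => /eqP; rewrite mulr1 mulr0 subr0 eq_sym oppr_eq0 oner_eq0.
have g0 := Gz 0; have g1 := Gz 1.
apply: (mulIf d0); rewrite mul0r.
case: (ord2P k) => ->.
  transitivity (G 1 1 * (\sum_k z k * G k 0) - G 1 0 * (\sum_k z k * G k 1)).
    by rewrite /dG' !sum2E; ring.
  by rewrite g0 g1; ring.
transitivity (G 0 0 * (\sum_k z k * G k 1) - G 0 1 * (\sum_k z k * G k 0)).
  by rewrite /dG' !sum2E; ring.
by rewrite g0 g1; ring.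
Qed.

Lemma null_pair_commute F dF (tau dA dB : 'I_2 -> K) (A B c : K) :
  (forall k, \sum_a (F 0 a * dF a 1 k - F 1 a * dF a 0 k) =
    tau 0 * F 0 k - tau 1 * F 1 k) ->
  \sum_a (F 0 a - F 1 a) * dA a = - ((tau 0 - tau 1) * A) ->
  \sum_a (F 0 a + F 1 a) * dB a = (tau 0 + tau 1) * B ->
  forall k, \sum_a
    (c * (A * (F 0 a + F 1 a)) *
       (c * (dB a * (F 0 k - F 1 k) + B * (dF a 0 k - dF a 1 k)))
     - c * (B * (F 0 a - F 1 a)) *
       (c * (dA a * (F 0 k + F 1 k) + A * (dF a 0 k + dF a 1 k)))) = 0.
Proof.
move=> br hA hB k.
transitivity (c ^+ 2 * (A * (\sum_a (F 0 a + F 1 a) * dB a) * (F 0 k - F 1 k)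
   - B * (\sum_a (F 0 a - F 1 a) * dA a) * (F 0 k + F 1 k)
   - 2 * A * B * \sum_a (F 0 a * dF a 1 k - F 1 a * dF a 0 k))).
  by rewrite !sum2E; ring.
by rewrite hA hB br; ring.
Qed.

End ConnectionAlgebra.

Section CliffordAlgebra.
Variable R : realType.
Local Notation C := R[i].

Lemma mul_mx2 (K : comPzRingType) (a b c d a' b' c' d' : K) :
  mx2 a b c d *m mx2 a' b' c' d' =
  mx2 (a * a' + b * c') (a * b' + b * d') (c * a' + d * c') (c * b' + d * d').
Proof.
by apply/matrixP => i j; case: (ord2P i) => ->; case: (ord2P j) => ->;
  rewrite !mxE sum2E !mxE.
Qed.

Lemma cliffE (x : 'rV[R]_2) :
  cliff x = mx2 0 (0 +i* (x 0 0 + x 0 1)) (0 +i* (x 0 1 - x 0 0)) 0.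
Proof.
apply/matrixP => i j; rewrite /cliff !mxE.
case: (ord2P i) => ->; case: (ord2P j) => -> /=; simpc => //.
by rewrite addrC.
Qed.

Lemma minkE (x : 'rV[R]_2) : mink x = (x 0 1 + x 0 0) * (x 0 1 - x 0 0).
Proof. by rewrite /mink pairingE !sum2E !mxE /=; ring. Qed.

Lemma unit_product (s : seq 'rV[R]_2) : (forall x, x \in s -> `|mink x| = 1) ->
  exists u v : R, `|u * v| = 1 /\ \big[mulmx/1%:M]_(x <- s) cliff x =
    if odd (size s) then mx2 0 (0 +i* u) (0 +i* v) 0 else mx2 u%:C 0 0 v%:C.
Proof.
elim: s => [|x s IH] H.
  exists 1, 1; rewrite mulr1 normr1 big_nil; split=> //.
  by apply/matrixP => i j; case: (ord2P i) => ->; case: (ord2P j) => ->; rewrite !mxE.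
have [|u [v [uv E]]] := IH; first by move=> y ys; apply: H; rewrite inE ys orbT.
have hx : `|mink x| = 1 by apply: H; rewrite inE eqxx.
rewrite big_cons E cliffE /=; case: (odd (size s)) => /=.
  exists (- ((x 0 0 + x 0 1) * v)), (- ((x 0 1 - x 0 0) * u)); split.
    have -> : - ((x 0 0 + x 0 1) * v) * - ((x 0 1 - x 0 0) * u) = mink x * (u * v).
      by rewrite minkE; ring.
    by rewrite normrM hx uv mulr1.
  by rewrite mul_mx2; congr mx2; simpc.
exists ((x 0 0 + x 0 1) * v), ((x 0 1 - x 0 0) * u); split.
  have -> : (x 0 0 + x 0 1) * v * ((x 0 1 - x 0 0) * u) = mink x * (u * v).
    by rewrite minkE; ring.
  by rewrite normrM hx uv mulr1.
by rewrite mul_mx2; congr mx2; simpc.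
Qed.

Lemma spin11P (a : 'M[C]_2) : spin11 a -> exists u v : R,
  `|u * v| = 1 /\ a = mx2 u%:C 0 0 v%:C.
Proof.
move=> [s [es us ->]]; have [u [v [uv E]]] := unit_product us.
by exists u, v; rewrite E (negbTE es).
Qed.

Lemma spin_covers_boost (u v : R) (L : 'M[R]_2) :
  spin_covers (mx2 u%:C 0 0 v%:C) L ->
  [/\ u = v * (L 0 0 + L 0 1), u = v * (L 1 0 + L 1 1),
      v = u * (L 0 0 - L 0 1) & v = u * (L 1 1 - L 1 0)].
Proof.
move=> H.
have e (x : 'rV[R]_2) : u * (x 0 0 + x 0 1) = ((x *m L) 0 0 + (x *m L) 0 1) * v /\
    v * (x 0 1 - x 0 0) = ((x *m L) 0 1 - (x *m L) 0 0) * u.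
  have := H x; rewrite !cliffE !mul_mx2 => E.
  have := congr1 (fun A : 'M[C]_2 => complex.Im (A 0 1)) E.
  have := congr1 (fun A : 'M[C]_2 => complex.Im (A 1 0)) E.
  by rewrite !mxE /=; simpc => /= -> ->.
have [] := e (delta_mx 0 0); have [] := e (delta_mx 0 1).
rewrite -!rowE !mxE /= => h1 h2 h3 h4; split.
- by rewrite mulrC -h3; ring.
- by rewrite mulrC -h1; ring.
- lra.
- lra.
Qed.

Definition normsq (z : C) : R := complex.Re z ^+ 2 + complex.Im z ^+ 2.

Lemma normsq_gt0 (z : C) : z != 0 -> 0 < normsq z.
Proof.
case: z => a b; rewrite eq_complex /= negb_and /normsq /= => /orP[h|h].
  by rewrite ltr_pwDl ?sqr_ge0// lt_neqAle sqr_ge0 andbT eq_sym sqrf_eq0.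
by rewrite ltr_wpDl ?sqr_ge0// lt_neqAle sqr_ge0 andbT eq_sym sqrf_eq0.
Qed.

Lemma normsqZ (u : R) (z : C) : normsq (u%:C * z) = u ^+ 2 * normsq z.
Proof. by case: z => a b; rewrite /normsq; simpc => /=; ring. Qed.

Lemma complex_linear_eq0 (z w : C) (u : R) : z + u%:C * w = 0 ->
  complex.Re z + u * complex.Re w = 0 /\ complex.Im z + u * complex.Im w = 0.
Proof. by case: z => a b; case: w => c d; simpc => -[/= -> ->]. Qed.

Lemma twistor_components (X0 X1 : 'cV[C]_2) :
  X0 = - (2^-1 *: (cliff (delta_mx 0 0 : 'rV[R]_2) *m
          (- (cl1 R *m X0) + cl2 R *m X1))) ->
  X0 0 0 = X1 0 0 /\ X0 1 0 = - X1 1 0.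
Proof.
rewrite cliffE !mxE /= => E.
have e0 := congr1 (fun A : 'cV[C]_2 => A 0 0) E.
have e1 := congr1 (fun A : 'cV[C]_2 => A 1 0) E.
move: e0 e1; rewrite !mxE !sum2E !mxE !sum2E !mxE /=.
move: (X0 0 0) (X0 1 0) (X1 0 0) (X1 1 0) => a b c d.
set I := (0 +i* 1 : C).
have II : I * I = -1 by rewrite /I; simpc.
have -> : 0 +i* (1 + 0) = I by rewrite addr0.
have -> : 0 +i* (0 - 1) = - I by rewrite /I sub0r; simpc.
move=> h0 h1.
have t : (2 : C) != 0 by rewrite pnatr_eq0.
have k0 : 2 * a = a + c.
  rewrite {1}h0.
  transitivity (- (2 * 2^-1) * (I * I) * (a + c)); first by ring.
  by rewrite divff// II; ring.
have k1 : 2 * b = b - d.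
  rewrite {1}h1.
  transitivity (- (2 * 2^-1) * (I * I) * (b - d)); first by ring.
  by rewrite divff// II; ring.
split; first by apply/(addrI a); rewrite -k0; ring.
by apply/(addrI b); rewrite -k1; ring.
Qed.

End CliffordAlgebra.

Section LocalCalculus.
Variable R : realType.
Implicit Types (W : set 'rV[R]_2) (x : 'rV[R]_2).

Lemma Ck_sum2 n W (f : 'I_2 -> 'rV[R]_2 -> R) : open W ->
  (forall a, Ck n W (f a)) -> Ck n W (fun x => \sum_a f a x).
Proof.
move=> oW Cf; apply: (Ck_ext oW _ (CkD oW (Cf 0) (Cf 1))) => x _.
by rewrite sum2E.
Qed.

Lemma derivable_sum2 (f : 'I_2 -> 'rV[R]_2 -> R) x c :
  (forall a, derivable (f a) x (delta_mx 0 c)) ->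
  derivable (fun y => \sum_a f a y) x (delta_mx 0 c).
Proof.
move=> df; have := derivableD (df 0) (df 1).
by rewrite (_ : f 0 + f 1 = fun y => \sum_a f a y)//; apply/funext => y; rewrite sum2E.
Qed.

Lemma pd_sum2 (f : 'I_2 -> 'rV[R]_2 -> R) x c :
  (forall a, derivable (f a) x (delta_mx 0 c)) ->
  pd c (fun y => \sum_a f a y) x = \sum_a pd c (f a) x.
Proof.
move=> df; rewrite sum2E -(pdD (df 0) (df 1)); congr (pd c _ x).
by apply/funext => y; rewrite sum2E.
Qed.

Lemma pd_triple (u v w : 'rV[R]_2 -> R) x c :
  derivable u x (delta_mx 0 c) -> derivable v x (delta_mx 0 c) ->
  derivable w x (delta_mx 0 c) ->
  pd c (fun y => u y * v y * w y) x =
  pd c u x * v x * w x + u x * pd c v x * w x + u x * v x * pd c w x.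
Proof.
move=> du dv dw; rewrite (pdM (derivableM du dv) dw) (pdM du dv) mulrDl.
by [].
Qed.

Lemma Ck_normsq n W (z : 'rV[R]_2 -> R[i]) : open W ->
  Ck n W (fun x => complex.Re (z x)) -> Ck n W (fun x => complex.Im (z x)) ->
  Ck n W (fun x => normsq (z x)).
Proof.
move=> oW Cr Ci; apply: (Ck_ext oW _ (CkD oW (CkM oW Cr Cr) (CkM oW Ci Ci))) => x _.
by rewrite /normsq !expr2.
Qed.

Lemma pd_normsq (z : 'rV[R]_2 -> R[i]) x c :
  derivable (fun x => complex.Re (z x)) x (delta_mx 0 c) ->
  derivable (fun x => complex.Im (z x)) x (delta_mx 0 c) ->
  pd c (fun x => normsq (z x)) x =
  2 * (complex.Re (z x) * pd c (fun x => complex.Re (z x)) x +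
       complex.Im (z x) * pd c (fun x => complex.Im (z x)) x).
Proof.
move=> dr di.
have -> : (fun x => normsq (z x)) = (fun x => complex.Re (z x) * complex.Re (z x)
  + complex.Im (z x) * complex.Im (z x)).
  by apply/funext => y; rewrite /normsq !expr2.
rewrite (pdD (derivableM dr dr) (derivableM di di)) (pdM dr dr) (pdM di di).
move: (pd c _ x) (pd c _ x) => p q; ring.
Qed.

End LocalCalculus.

Section SpinorFrame.
Variables (R : realType) (M : topologicalType) (S : oriented_surface R M).
Variables (g : lorentz_metric S) (Q : spin_structure g).
Local Notation C := R[i].
Variables (psip psim : Q -> 'cV[C]_2) (T : chart S -> M -> 'rV[R]_2).
Hypothesis T_smooth : smooth_vector_field T.
Hypothesis T_timelike : forall i p, dom i p -> pairing (g i p) (T i p) (T i p) < 0.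
Hypothesis psip_plus : section_Splus psip.
Hypothesis psip_twistor : twistor psip.
Hypothesis psip_neq0 : nowhere_zero psip.
Hypothesis psim_minus : section_Sminus psim.
Hypothesis psim_twistor : twistor psim.
Hypothesis psim_neq0 : nowhere_zero psim.
Implicit Types (i j : chart S) (p : M) (q : Q).

Definition null_row (m : 'I_2) (F : 'M[R]_2) : 'rV[R]_2 :=
  row 0 F + (if m == 0 then 1 else -1) *: row 1 F.

Definition weight (m : 'I_2) q : R :=
  if m == 0 then normsq (psip q 0 0) else normsq (psim q 1 0).

(* [spin11] contains elements reversing both time and space, which change the
   sign of the null vectors; the time-like field [T] fixes this sign globally. *)
Definition orientation_sign i q : R :=
  Num.sg (pairing (g i (Defs.proj q)) (T i (Defs.proj q)) (null_row 0 (frm q i))).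

Definition spinor_field_vector m i q : 'rV[R]_2 :=
  orientation_sign i q *: (weight m q *: null_row m (frm q i)).

Lemma cl12E : cl1 R *m cl2 R = mx2 (-1) 0 0 1.
Proof. by rewrite mul_mx2; congr mx2; simpc. Qed.

Lemma psip_second0 q : psip q 1 0 = 0.
Proof.
have [_ /(_ q)] := psip_plus; rewrite cl12E => /matrixP/(_ 1 0).
rewrite !mxE sum2E !mxE /= mul0r mul1r add0r => /eqP.
by rewrite -subr_eq0 opprK -mulr2n -mulr_natl mulf_eq0 pnatr_eq0 /= => /eqP.
Qed.

Lemma psim_first0 q : psim q 0 0 = 0.
Proof.
have [_ /(_ q)] := psim_minus; rewrite cl12E => /matrixP/(_ 0 0).
rewrite !mxE sum2E !mxE /= mul0r addr0 mulN1r => /eqP.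
by rewrite eq_sym -subr_eq0 opprK -mulr2n -mulr_natl mulf_eq0 pnatr_eq0 /= => /eqP.
Qed.

Lemma weight_gt0 m q : 0 < weight m q.
Proof.
rewrite /weight; case: (ord2P m) => -> /=; apply: normsq_gt0; apply/eqP => h.
  have /eqP := psip_neq0 q; apply; apply/matrixP => a b; rewrite (ord1 b) mxE.
  by case: (ord2P a) => ->; [exact: h|exact: psip_second0].
have /eqP := psim_neq0 q; apply; apply/matrixP => a b; rewrite (ord1 b) mxE.
by case: (ord2P a) => ->; [exact: psim_first0|exact: h].
Qed.

Lemma pairingZ (G : 'M[R]_2) a b (v w : 'rV[R]_2) :
  pairing G (a *: v) (b *: w) = a * b * pairing G v w.
Proof. by rewrite !pairingE !sum2E !mxE; ring. Qed.

Lemma pairing_row (G F : 'M[R]_2) a b :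
  pairing G (row a F) (row b F) = (F *m G *m F^T) a b.
Proof. by rewrite pairingE !mxE !sum2E !mxE !sum2E; ring. Qed.

Lemma pairing_null_row (G F : 'M[R]_2) m n : F *m G *m F^T = eta R ->
  pairing G (null_row m F) (null_row n F) = (m != n)%:R * - 2.
Proof.
move=> o; have e a b : pairing G (row a F) (row b F) = eta R a b.
  by rewrite pairing_row o.
pose s (m : 'I_2) : R := if m == 0 then 1 else -1.
transitivity (pairing G (row 0 F) (row 0 F) + s n * pairing G (row 0 F) (row 1 F)
  + s m * (pairing G (row 1 F) (row 0 F) + s n * pairing G (row 1 F) (row 1 F))).
  by rewrite !pairingE !sum2E !mxE /s; ring.
rewrite !e !mxE /s /=.
by case: (ord2P m) => ->; case: (ord2P n) => -> /=; ring.
Qed.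

Lemma timelike_pairing_neq0 (G F : 'M[R]_2) (t : 'rV[R]_2) :
  F *m G *m F^T = eta R -> 0 < \det F -> pairing G t t < 0 ->
  pairing G t (null_row 0 F) != 0.
Proof.
move=> o d tt; have u : F \in unitmx by rewrite unitmxE unitfE gt_eqF.
have [y yE] : exists y, t = y *m F.
  by exists (t *m invmx F); rewrite -mulmxA mulVmx// mulmx1.
have pE (w : 'rV[R]_2) : pairing G t (w *m F) = - (y 0 0 * w 0 0) + y 0 1 * w 0 1.
  rewrite /pairing yE trmx_mul !mulmxA -(mulmxA y) -(mulmxA y) o.
  by rewrite !mxE sum2E !mxE !sum2E !mxE /=; ring.
have nE : null_row 0 F = (\row_k 1) *m F.
  by apply/rowP => k; rewrite !mxE sum2E !mxE /=; ring.
rewrite nE pE !mxE !mulr1; apply/eqP => e.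
move: tt; rewrite {2}yE pE; apply/negP; rewrite -leNgt.
have -> : y 0 1 = y 0 0 by apply/eqP; rewrite -subr_eq0 addrC; exact/eqP.
by rewrite addNr.
Qed.

Lemma sign_neq0 i q : dom i (Defs.proj q) ->
  pairing (g i (Defs.proj q)) (T i (Defs.proj q)) (null_row 0 (frm q i)) != 0.
Proof.
move=> di; apply: timelike_pairing_neq0; [exact: frm_orthonormal|exact: frm_oriented|].
exact: T_timelike.
Qed.

Lemma orientation_sign_sqr i q : dom i (Defs.proj q) -> orientation_sign i q ^+ 2 = 1.
Proof. by move=> di; rewrite /orientation_sign sqr_sg sign_neq0. Qed.

Lemma spin_act q (a : 'M[C]_2) : spin11 a ->
  weight 0 (act q a) * weight 1 (act q a) = weight 0 q * weight 1 q /\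
  forall m i, dom i (Defs.proj q) ->
    spinor_field_vector m i (act q a) = spinor_field_vector m i q.
Proof.
move=> sa; have [u [v [uv aE]]] := spin11P sa.
have uv0 : u * v != 0 by apply/eqP => h; move: uv; rewrite h normr0 => /eqP; rewrite eq_sym oner_eq0.
have [u0 v0] : u != 0 /\ v != 0 by move: uv0; rewrite mulf_eq0 negb_or => /andP[].
have ua : a \in unitmx.
  have : a *m mx2 (u^-1)%:C 0 0 (v^-1)%:C = 1%:M.
    rewrite aE mul_mx2 !mulr0 !mul0r !addr0 !add0r -!rmorphM /= !divff//.
    by apply/matrixP => b c; case: (ord2P b) => ->; case: (ord2P c) => ->; rewrite !mxE.
  by move=> /mulmx1_unit[].
have eqv (psi : Q -> 'cV[C]_2) : spinor_field psi -> psi q = a *m psi (act q a).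
  by move=> [h _]; rewrite h// mulmxA mulmxV// mul1mx.
have wP : weight 0 q = u ^+ 2 * weight 0 (act q a).
  have [sp _] := psip_plus; rewrite /weight /= (eqv _ sp) aE mxE sum2E !mxE /=.
  by rewrite mul0r addr0 normsqZ.
have wM : weight 1 q = v ^+ 2 * weight 1 (act q a).
  have [sp _] := psim_minus; rewrite /weight /= (eqv _ sp) aE mxE sum2E !mxE /=.
  by rewrite mul0r add0r normsqZ.
have uv2 : u ^+ 2 * v ^+ 2 = 1 by rewrite -exprMn -real_normK ?num_real// uv expr1n.
split; first by rewrite wP wM -[LHS]mul1r -uv2; ring.
move=> m i di; have [L cov fL] := frm_act q sa; rewrite aE in cov.
have [h1 h2 h3 h4] := spin_covers_boost cov.
have pq : Defs.proj (act q a) = Defs.proj q by exact: act_proj.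
have fE := fL i di.
have [n0 n1] : null_row 0 (frm (act q a) i) = (u / v) *: null_row 0 (frm q i) /\
               null_row 1 (frm (act q a) i) = (v / u) *: null_row 1 (frm q i).
  have e1 : u / v = L 0 0 + L 0 1 by rewrite {1}h1 mulrC mulKf.
  have e2 : u / v = L 1 0 + L 1 1 by rewrite {1}h2 mulrC mulKf.
  have e3 : v / u = L 0 0 - L 0 1 by rewrite {1}h3 mulrC mulKf.
  have e4 : v / u = L 1 1 - L 1 0 by rewrite {1}h4 mulrC mulKf.
  have [s0 s1 s2 s3] : [/\ L 0 0 + L 1 0 = u / v, L 0 1 + L 1 1 = u / v,
      L 0 0 - L 1 0 = v / u & L 0 1 - L 1 1 = - (v / u)].
    by move: e1 e2 e3 e4; move: (u / v) (v / u) => x y *; split; lra.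
  rewrite fE; split; apply/rowP => k; rewrite !mxE !sum2E /=.
    transitivity ((L 0 0 + L 1 0) * frm q i 0 k + (L 0 1 + L 1 1) * frm q i 1 k).
      by ring.
    by rewrite s0 s1; ring.
  transitivity ((L 0 0 - L 1 0) * frm q i 0 k + (L 0 1 - L 1 1) * frm q i 1 k).
    by ring.
  by rewrite s2 s3; ring.
have uvS : u / v = (u * v) * u ^+ 2.
  apply: (mulIf v0); rewrite mulfVK//.
  by rewrite -[LHS]mulr1 -uv2; ring.
have vuS : v / u = (u * v) * v ^+ 2.
  apply: (mulIf u0); rewrite mulfVK//.
  by rewrite -[LHS]mulr1 -uv2; ring.
have sgn : orientation_sign i (act q a) = (u * v) * orientation_sign i q.
  rewrite /orientation_sign pq n0.
  rewrite -[T i (Defs.proj q) in LHS]scale1r pairingZ mul1r.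
  rewrite sgrM; congr (_ * _); have u2 : 0 < u ^+ 2 by rewrite exprn_even_gt0.
  by rewrite uvS sgrM (gtr0_sg u2) mulr1 [RHS]numEsg uv mulr1.
have uv1 : (u * v) ^+ 2 = 1 by rewrite exprMn.
rewrite /spinor_field_vector sgn; case: (ord2P m) => ->.
  rewrite n0 uvS wP !scalerA; congr (_ *: _).
  transitivity ((u * v) ^+ 2 * (orientation_sign i q * (u ^+ 2 * weight 0 (act q a)))).
    by ring.
  by rewrite uv1 mul1r.
rewrite n1 vuS wM !scalerA; congr (_ *: _).
transitivity ((u * v) ^+ 2 * (orientation_sign i q * (v ^+ 2 * weight 1 (act q a)))).
  by ring.
by rewrite uv1 mul1r.
Qed.

Lemma same_fiber q q' : Defs.proj q = Defs.proj q' ->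
  weight 0 q * weight 1 q = weight 0 q' * weight 1 q' /\
  forall m i, dom i (Defs.proj q) ->
    spinor_field_vector m i q = spinor_field_vector m i q'.
Proof.
move=> qq; have [U [s [d [Up [_ ps _ _] tr _ _]]]] := locally_trivial Q (Defs.proj q).
have [d1 e1] := tr q Up; have Up' : U (Defs.proj q') by rewrite -qq.
have [d2 e2] := tr q' Up'; rewrite -qq in e2.
have [w1 v1] := spin_act (s (Defs.proj q)) d1.
have [w2 v2] := spin_act (s (Defs.proj q)) d2.
rewrite -e1 in w1 v1; rewrite -e2 in w2 v2; rewrite w1 w2; split=> // m i di.
by rewrite v1 ?v2 // ps.
Qed.

Lemma fiber_point p : exists q : Q, Defs.proj q = p.
Proof.
have [U [s [d [Up [_ ps _ _] _ _ _]]]] := locally_trivial Q p.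
by exists (s p); exact: ps.
Qed.

Definition lift p : Q := sval (cid (fiber_point p)).

Lemma liftK p : Defs.proj (lift p) = p.
Proof. exact: svalP (cid (fiber_point p)). Qed.

Definition spin_vector m i p := spinor_field_vector m i (lift p).

Definition spin_weight p := weight 0 (lift p) * weight 1 (lift p).

Lemma spin_vectorE m i q : dom i (Defs.proj q) ->
  spin_vector m i (Defs.proj q) = spinor_field_vector m i q.
Proof.
move=> di; have [_ h] := same_fiber (liftK (Defs.proj q)).
by rewrite /spin_vector h// liftK.
Qed.

Lemma spin_weightE q : spin_weight (Defs.proj q) = weight 0 q * weight 1 q.
Proof. by have [h _] := same_fiber (liftK (Defs.proj q)). Qed.

Lemma null_rowM m (F A : 'M[R]_2) : null_row m (F *m A) = null_row m F *m A.
Proof. by apply/rowP => k; rewrite !mxE !sum2E !mxE; ring. Qed.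

Lemma spin_vector_trans m i j p : dom i p -> dom j p ->
  spin_vector m j p = spin_vector m i p *m jac i j p.
Proof.
move=> di dj; rewrite /spin_vector /spinor_field_vector /orientation_sign.
have fj := @frm_trans _ _ _ _ _ (lift p) i j; rewrite liftK in fj.
rewrite liftK (fj di dj) !null_rowM -!scalemxAl; congr (_ *: _).
congr (Num.sg _); rewrite (T_smooth.1 i j p di dj) (gm_trans g di dj).
by rewrite /pairing trmx_mul !mulmxA.
Qed.

Lemma spin_vector_gram m n i p : dom i p ->
  pairing (g i p) (spin_vector m i p) (spin_vector n i p) =
  (m != n)%:R * (- 2 * spin_weight p).
Proof.
move=> di; rewrite /spin_vector /spin_weight; move: (liftK p) => pl.
have dl : dom i (Defs.proj (lift p)) by rewrite pl.
have := pairing_null_row m n (frm_orthonormal dl); rewrite pl => h.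
rewrite /spinor_field_vector.
transitivity (orientation_sign i (lift p) ^+ 2 * (weight m (lift p) * weight n (lift p)) *
  pairing (g i p) (null_row m (frm (lift p) i)) (null_row n (frm (lift p) i))).
  by rewrite !scalerA pairingZ; ring.
rewrite h orientation_sign_sqr//; case: (ord2P m) => ->; case: (ord2P n) => -> /=; ring.
Qed.

Section LocalSection.
Variables (i : chart S) (U : set M) (s : M -> Q).
Hypothesis sU : smooth_section U s.

Let W := img i U.
Let oU : open U. Proof. by have [] := sU. Qed.
Let oW : open W. Proof. exact: open_img. Qed.
Let F a b (x : 'rV[R]_2) : R := frm (s (pnt i x)) i a b.
Let G a b (x : 'rV[R]_2) : R := g i (pnt i x) a b.
Let ws m (x : 'rV[R]_2) : R := weight m (s (pnt i x)).
Let e (m : 'I_2) : R := if m == 0 then 1 else -1.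

Let proj_s p : U p -> Defs.proj (s p) = p. Proof. by have [_ + _ _] := sU; apply. Qed.

Lemma Ck_section_frame n a b : Ck n W (F a b).
Proof. by have [_ _ _ h] := sU; exact: h. Qed.

Lemma Ck_metric n a b : Ck n W (G a b).
Proof. by apply: Ck_sub (gm_smooth g i a b n) => x [p [dp _] <-]; exists p. Qed.

Lemma Ck_weight n m : Ck n W (ws m).
Proof.
rewrite /ws /weight; case: (ord2P m) => -> /=.
  have [[_ h] _] := psip_plus; have [hr hi] := h U s sU i 0.
  exact: (Ck_normsq oW (hr n) (hi n)).
have [[_ h] _] := psim_minus; have [hr hi] := h U s sU i 1.
exact: (Ck_normsq oW (hr n) (hi n)).
Qed.

Lemma section_frame_orthonormal x (r l : 'I_2) : W x ->
  \sum_a \sum_b F r a x * G a b x * F l b x = mink2 R r l.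
Proof.
move=> /imgP[dx Ux _].
have := @frm_orthonormal _ _ _ _ _ (s (pnt i x)) i; rewrite proj_s// => /(_ dx)/matrixP/(_ r l).
rewrite -pairing_row pairingE => h; rewrite /mink2.
transitivity (eta R r l).
  by rewrite -h; apply: eq_bigr => a _; apply: eq_bigr => b _; rewrite !mxE.
by rewrite mxE; case: (ord2P r) => ->; case: (ord2P l) => ->.
Qed.

Lemma spin_weight_local x : W x -> spin_weight (pnt i x) = ws 0 x * ws 1 x.
Proof. by move=> /imgP[_ Ux _]; rewrite -[in LHS](proj_s Ux) spin_weightE. Qed.

Lemma spin_vector_local p : dom i p -> U p -> exists W' c,
  [/\ open W', W' `<=` W, W' (crd i p), c ^+ 2 = 1 &
   forall m k x, W' x -> spin_vector m i (pnt i x) 0 k =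
     c * (ws m x * (F 0 k x + e m * F 1 k x))].
Proof.
move=> di Up; pose x0 := crd i p.
have Wx0 : W x0 by exact: img_crd.
pose t x := \sum_a \sum_b T i (pnt i x) 0 a * G a b x * (F 0 b x + F 1 b x).
have Ct : Ck 0 W t.
  apply: Ck_sum2 => // a; apply: Ck_sum2 => // b; apply: CkM => //.
    apply: CkM => //; last exact: Ck_metric.
    by apply: Ck_sub (T_smooth.2 i a 0%N) => x [p' [dp _] <-]; exists p'.
  by apply: CkD => //; exact: Ck_section_frame.
have tE x : W x -> orientation_sign i (s (pnt i x)) = Num.sg (t x).
  move=> /imgP[_ Ux _]; rewrite /orientation_sign proj_s// pairingE; congr Num.sg.
  apply: eq_bigr => a _; apply: eq_bigr => b _; congr (_ * _).
  by rewrite !mxE /= mul1r.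
have t0 : t x0 != 0.
  have [dx Ux _] := imgP Wx0.
  have : orientation_sign i (s (pnt i x0)) ^+ 2 = 1.
    by apply: orientation_sign_sqr; rewrite proj_s.
  by rewrite tE// sqr_sg; case: eqP => //= _ /eqP; rewrite eq_sym oner_eq0.
have ct := Ck_continuous Ct Wx0.
have n1 : \forall x \near x0, `|t x0 - t x| < `|t x0|.
  by have /cvgrPdist_lt := ct; apply; rewrite normr_gt0.
have n2 : \forall x \near x0, W x by exact: open_nbhs_nbhs.
pose W' := [set x | W x /\ `|t x0 - t x| < `|t x0|]^°.
exists W', (Num.sg (t x0)); split.
- exact: open_interior.
- by move=> x /interior_subset[].
- exact: filterI.
- by rewrite sqr_sg t0.
move=> m k x /interior_subset[Wx tx].
have [dx Ux _] := imgP Wx.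
have ps := proj_s Ux.
rewrite -{1}ps spin_vectorE ?ps// /spinor_field_vector !mxE tE//.
congr (_ * _); have := ltr_norml (t x0 - t x) `|t x0|.
rewrite tx => /esym/andP[h1 h2].
case: (ltgtP (t x0) 0) t0 => // t0 _.
  rewrite (ltr0_norm t0) in h1 h2; rewrite !ltr0_sg//; lra.
rewrite (gtr0_norm t0) in h1 h2; rewrite !gtr0_sg//; lra.
Qed.

Definition connection_form (r : 'I_2) p : R :=
  pairing (g i p) (nabla g i (row r (frm (s p) i))
    (fun y => row 0 (frm (s (pnt i y)) i)) (crd i p)) (row 1 (frm (s p) i)).

Lemma connection_formE r p : dom i p ->
  connection_form r p = \sum_a \sum_b
    (\sum_c F r c (crd i p) * (pd c (F 0 a) (crd i p) +
       \sum_d christoffel g i a c d (crd i p) * F 0 d (crd i p)))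
    * G a b (crd i p) * F 1 b (crd i p).
Proof.
move=> dp; rewrite /connection_form pairingE; apply: eq_bigr => a _.
apply: eq_bigr => b _; rewrite /G /F crdK// [row 1 _ 0 b]mxE; congr (_ * _ * _).
rewrite mxE; apply: eq_bigr => c _; rewrite [row r _ 0 c]mxE; congr (_ * (_ + _)).
  by congr (pd c _ _); apply/funext => y; rewrite mxE.
by apply: eq_bigr => d _; rewrite mxE crdK.
Qed.

Lemma nablaS_component (psi : Q -> 'cV[C]_2) (k r : 'I_2) (eps : R) p :
  (cl1 R *m cl2 R *m psi (s p)) k 0 = eps%:C * psi (s p) k 0 ->
  let X := nablaS psi s i (row r (frm (s p) i)) p k 0 in
  complex.Re X = \sum_a frm (s p) i r a *
      pd a (fun y => complex.Re (psi (s (pnt i y)) k 0)) (crd i p)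
    - 2^-1 * connection_form r p * eps * complex.Re (psi (s p) k 0) /\
  complex.Im X = \sum_a frm (s p) i r a *
      pd a (fun y => complex.Im (psi (s (pnt i y)) k 0)) (crd i p)
    - 2^-1 * connection_form r p * eps * complex.Im (psi (s p) k 0).
Proof.
move=> he /=; rewrite /nablaS [X in complex.Re X]mxE [X in complex.Im X]mxE.
rewrite ![(\col__ _) _ _]mxE ![(- _ : 'cV_2) _ _]mxE ![(_ *: _ : 'cV_2) _ _]mxE he.
rewrite -/(connection_form r p) !sum2E /pdC ![row _ _ _ _]mxE.
move: (pd 0 (fun y => complex.Re (psi (s (pnt i y)) k 0)) (crd i p))
  (pd 1 (fun y => complex.Re (psi (s (pnt i y)) k 0)) (crd i p))
  (pd 0 (fun y => complex.Im (psi (s (pnt i y)) k 0)) (crd i p))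
  (pd 1 (fun y => complex.Im (psi (s (pnt i y)) k 0)) (crd i p))
  (connection_form r p) (frm (s p) i r 0) (frm (s p) i r 1) (psi (s p) k 0).
by move=> r0 r1 i0 i1 t f0 f1 [u v]; split; simpc => /=; ring.
Qed.

Lemma weight_equation (psi : Q -> 'cV[C]_2) (k : 'I_2) (eps sig : R) p :
  dom i p -> U p -> spinor_field psi ->
  (cl1 R *m cl2 R *m psi (s p)) k 0 = eps%:C * psi (s p) k 0 ->
  nablaS psi s i (row 0 (frm (s p) i)) p k 0 +
    sig%:C * nablaS psi s i (row 1 (frm (s p) i)) p k 0 = 0 ->
  \sum_a (F 0 a (crd i p) + sig * F 1 a (crd i p)) *
    pd a (fun y => normsq (psi (s (pnt i y)) k 0)) (crd i p) =
  eps * (connection_form 0 p + sig * connection_form 1 p) * normsq (psi (s p) k 0).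
Proof.
move=> dp Up [_ sf] he eq0.
have [hr hi] := sf U s sU i k.
have Wp : W (crd i p) by exact: img_crd.
have dr a : derivable (fun y => complex.Re (psi (s (pnt i y)) k 0)) (crd i p) (delta_mx 0 a).
  exact: (Ck_derivable (hr 1%N) Wp).
have di a : derivable (fun y => complex.Im (psi (s (pnt i y)) k 0)) (crd i p) (delta_mx 0 a).
  exact: (Ck_derivable (hi 1%N) Wp).
have [re0 im0] := nablaS_component 0 he; have [re1 im1] := nablaS_component 1 he.
have [hre him] := complex_linear_eq0 eq0.
have {hre} := etrans (esym (f_equal2 (fun x y => x + sig * y) re0 re1)) hre.
have {him} := etrans (esym (f_equal2 (fun x y => x + sig * y) im0 im1)) him.
rewrite /= [in X in _ -> _ -> X = _]sum2E !(pd_normsq (dr _) (di _)) /F crdK// !sum2E /normsq.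
move: (pd 0 (fun y => complex.Re (psi (s (pnt i y)) k 0)) (crd i p))
  (pd 1 (fun y => complex.Re (psi (s (pnt i y)) k 0)) (crd i p))
  (pd 0 (fun y => complex.Im (psi (s (pnt i y)) k 0)) (crd i p))
  (pd 1 (fun y => complex.Im (psi (s (pnt i y)) k 0)) (crd i p)) (psi (s p) k 0).
move=> q0 q1 p0 p1 [u v] /= him hre.
have two : (2 : R) != 0 by rewrite pnatr_eq0.
apply/eqP; rewrite -subr_eq0; apply/eqP.
transitivity (2 * (u * (frm (s p) i 0 0 * q0 + frm (s p) i 0 1 * q1 -
     2^-1 * connection_form 0 p * eps * u +
     sig * (frm (s p) i 1 0 * q0 + frm (s p) i 1 1 * q1 - 2^-1 * connection_form 1 p * eps * u))
   + v * (frm (s p) i 0 0 * p0 + frm (s p) i 0 1 * p1 -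
     2^-1 * connection_form 0 p * eps * v +
     sig * (frm (s p) i 1 0 * p0 + frm (s p) i 1 1 * p1 - 2^-1 * connection_form 1 p * eps * v)))).
  by field.
by rewrite hre him; ring.
Qed.

Lemma metric_unit p : dom i p -> U p -> g i p \in unitmx.
Proof.
move=> dp Up; have := @frm_orthonormal _ _ _ _ _ (s p) i; rewrite proj_s// => /(_ dp) o.
have ee : eta R *m eta R = 1%:M.
  by apply/matrixP => a b; rewrite !mxE sum2E !mxE;
    case: (ord2P a) => ->; case: (ord2P b) => -> /=; ring.
have : (frm (s p) i *m g i p) *m ((frm (s p) i)^T *m eta R) = 1%:M.
  by rewrite mulmxA o ee.
by move=> /mulmx1_unit[]; rewrite unitmx_mul => /andP[].
Qed.

Lemma section_frame_bracket p : dom i p -> U p -> forall k,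
  \sum_a (F 0 a (crd i p) * pd a (F 1 k) (crd i p)
          - F 1 a (crd i p) * pd a (F 0 k) (crd i p)) =
  connection_form 0 p * F 0 k (crd i p) - connection_form 1 p * F 1 k (crd i p).
Proof.
move=> dp Up; set x := crd i p.
have Wx : W x by exact: img_crd.
have two : (2 : R) != 0 by rewrite pnatr_eq0.
have Gs y a b : W y -> G a b y = G b a y.
  by move=> /imgP[dy _ _]; rewrite /G -[in RHS](gm_sym g dy) mxE.
have dG a b c : derivable (G a b) x (delta_mx 0 c).
  exact: Ck_derivable (Ck_metric 1 a b) Wx.
have dF a b c : derivable (F a b) x (delta_mx 0 c).
  exact: Ck_derivable (Ck_section_frame 1 a b) Wx.
pose dGx c a b := pd c (G a b) x.
pose Cx k a b := christoffel g i k a b x.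
have [Cs Cc] : (forall k a b, Cx k a b = Cx k b a) /\
    forall c a b, dGx c a b = \sum_d (Cx d c a * G d b x) + \sum_d (Cx d c b * G a d x).
  apply: (@christoffel_compat _ (fun a b => G a b x)
    (fun a b => invmx (g i (pnt i x)) a b)) => //.
  - by move=> a b; exact: Gs.
  - by move=> c a b; apply: (pd_ext c oW _ Wx) => y; exact: Gs.
  - have u : g i (pnt i x) \in unitmx by rewrite crdK//; exact: metric_unit.
    by move=> l m; have := congr1 (fun A : 'M[R]_2 => A l m) (mulmxV u); rewrite !mxE.
apply: (@frame_bracket _ (fun a b => F a b x) (fun a b => G a b x) dGx Cx
  (fun c a b => pd c (F a b) x) (connection_form ^~ p) two _ Cs Cc).
- by move=> a b; exact: Gs.
- by move=> r l; exact: section_frame_orthonormal.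
- move=> c r l.
  have d3 a b : derivable (fun y => F r a y * G a b y * F l b y) x (delta_mx 0 c).
    exact: (derivableM (derivableM (dF r a c) (dG a b c)) (dF l b c)).
  have d2 a : derivable (fun y => \sum_b F r a y * G a b y * F l b y) x (delta_mx 0 c).
    exact: derivable_sum2.
  apply: etrans (pd_cst (mink2 R r l) x c).
  rewrite -(pd_ext c oW (fun y => @section_frame_orthonormal y r l) Wx).
  rewrite (pd_sum2 d2); apply: eq_bigr => a _.
  rewrite (pd_sum2 (d3 a)); apply: eq_bigr => b _.
  by rewrite (pd_triple (dF r a c) (dG a b c) (dF l b c)).
- by move=> r; exact: connection_formE.
Qed.

Lemma spin_vector_commute p : dom i p -> U p -> forall k, \sum_a
  (spin_vector 0 i p 0 a * pd a (fun x => spin_vector 1 i (pnt i x) 0 k) (crd i p)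
   - spin_vector 1 i p 0 a * pd a (fun x => spin_vector 0 i (pnt i x) 0 k) (crd i p)) = 0.
Proof.
move=> dp Up k; have [W' [c [oW' W'W W'x _ rep]]] := spin_vector_local dp Up.
have Wx := W'W _ W'x.
have dF a b l : derivable (F a b) (crd i p) (delta_mx 0 l).
  exact: Ck_derivable (Ck_section_frame 1 a b) Wx.
have dw m l : derivable (ws m) (crd i p) (delta_mx 0 l).
  exact: Ck_derivable (Ck_weight 1 m) Wx.
have vE m a : spin_vector m i p 0 a = c * (ws m (crd i p) *
    (F 0 a (crd i p) + e m * F 1 a (crd i p))).
  by rewrite -rep// crdK.
have dV m a : pd a (fun x => spin_vector m i (pnt i x) 0 k) (crd i p) =
    c * (pd a (ws m) (crd i p) * (F 0 k (crd i p) + e m * F 1 k (crd i p))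
      + ws m (crd i p) * (pd a (F 0 k) (crd i p) + e m * pd a (F 1 k) (crd i p))).
  rewrite (pd_ext a oW' (rep m k) W'x).
  have d1 : derivable (fun x => e m * F 1 k x) (crd i p) (delta_mx 0 a).
    exact: (derivableM (derivable_cst _ _ _) (dF 1 k a)).
  have d2 := derivableD (dF 0 k a) d1.
  rewrite (pdZ c (derivableM (dw m a) d2)) (pdM (dw m a) d2).
  by rewrite (pdD (dF 0 k a) d1) (pdZ _ (dF 1 k a)).
have tw (psi : Q -> 'cV[C]_2) : twistor psi ->
  nablaS psi s i (row 0 (frm (s p) i)) p 0 0 =
    nablaS psi s i (row 1 (frm (s p) i)) p 0 0 /\
  nablaS psi s i (row 0 (frm (s p) i)) p 1 0 =
    - nablaS psi s i (row 1 (frm (s p) i)) p 1 0.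
  move=> tpsi; apply: twistor_components.
  by have := tpsi U s sU i p Up dp (delta_mx 0 0); rewrite -rowE.
have hA : \sum_a (F 0 a (crd i p) - F 1 a (crd i p)) * pd a (ws 0) (crd i p) =
    - ((connection_form 0 p - connection_form 1 p) * ws 0 (crd i p)).
  have [sp cl] := psip_plus.
  have he : (cl1 R *m cl2 R *m psip (s p)) 0 0 = (-1 : R)%:C * psip (s p) 0 0.
    by rewrite cl mxE rmorphN /= rmorph1 mulN1r.
  have eq0 : nablaS psip s i (row 0 (frm (s p) i)) p 0 0 +
      (-1 : R)%:C * nablaS psip s i (row 1 (frm (s p) i)) p 0 0 = 0.
    have [e0 _] := tw _ psip_twistor.
    by rewrite rmorphN /= rmorph1 mulN1r; apply/eqP; rewrite subr_eq0; exact/eqP.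
  have h := weight_equation dp Up sp he eq0.
  transitivity (-1 * (connection_form 0 p + -1 * connection_form 1 p) *
      normsq (psip (s p) 0 0)).
    by rewrite -h; apply: eq_bigr => a _; rewrite mulN1r.
  by rewrite /ws /weight /= crdK//; ring.
have hB : \sum_a (F 0 a (crd i p) + F 1 a (crd i p)) * pd a (ws 1) (crd i p) =
    (connection_form 0 p + connection_form 1 p) * ws 1 (crd i p).
  have [sp cl] := psim_minus.
  have he : (cl1 R *m cl2 R *m psim (s p)) 1 0 = (1 : R)%:C * psim (s p) 1 0.
    by rewrite cl rmorph1 mul1r.
  have eq0 : nablaS psim s i (row 0 (frm (s p) i)) p 1 0 +
      (1 : R)%:C * nablaS psim s i (row 1 (frm (s p) i)) p 1 0 = 0.
    have [_ e1] := tw _ psim_twistor.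
    by rewrite rmorph1 mul1r; apply/eqP; rewrite addr_eq0; exact/eqP.
  have h := weight_equation dp Up sp he eq0.
  transitivity (1 * (connection_form 0 p + 1 * connection_form 1 p) *
      normsq (psim (s p) 1 0)).
    by rewrite -h; apply: eq_bigr => a _; rewrite mul1r.
  by rewrite /ws /weight /= crdK//; ring.
have := @null_pair_commute _ (fun a b => F a b (crd i p))
  (fun c a b => pd c (F a b) (crd i p)) (connection_form ^~ p)
  (fun a => pd a (ws 0) (crd i p)) (fun a => pd a (ws 1) (crd i p))
  (ws 0 (crd i p)) (ws 1 (crd i p)) c (section_frame_bracket dp Up) hA hB k.
apply: etrans; apply: eq_bigr => a _; rewrite !vE !dV /e /=.
by rewrite !mulN1r !mul1r.
Qed.

End LocalSection.

Lemma local_section p : exists U (s : M -> Q), smooth_section U s /\ U p.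
Proof.
have [U [s [d [Up sU _ _ _]]]] := locally_trivial Q p.
by exists U, s.
Qed.

Lemma spinor_null_frame : conformal_null_frame g spin_vector spin_weight.
Proof.
split.
- exact: spin_vector_trans.
- move=> m i k n; apply: Ck_local => x /imgP[dx _ ex].
  have [U [s [sU Up]]] := local_section (pnt i x).
  have [W' [c [oW' W'W W'x _ rep]]] := spin_vector_local sU dx Up.
  rewrite ex in W'x; exists W' => //.
  apply: (@Ck_ext _ _ _ (fun x => c * (weight m (s (pnt i x)) *
    (frm (s (pnt i x)) i 0 k + (if m == 0 then 1 else -1) * frm (s (pnt i x)) i 1 k)))) => //.
    by move=> y W'y; rewrite rep.
  apply: CkM => //; first exact: Ck_cst.
  apply: CkM => //; first exact: (Ck_sub W'W (Ck_weight i sU n m)).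
  apply: CkD => //; first exact: (Ck_sub W'W (Ck_section_frame i sU n 0 k)).
  apply: CkM => //; first exact: Ck_cst.
  exact: (Ck_sub W'W (Ck_section_frame i sU n 1 k)).
- move=> i n; apply: Ck_local => x /imgP[dx _ ex].
  have [U [s [sU Up]]] := local_section (pnt i x).
  have oU : open U by have [] := sU.
  exists (img i U); first by rewrite -ex; exact: img_crd.
  apply: (@Ck_ext _ _ _ (fun x => weight 0 (s (pnt i x)) * weight 1 (s (pnt i x)))).
  + exact: open_img.
  + by move=> y Wy; rewrite (spin_weight_local sU).
  + by apply: CkM; [exact: open_img|exact: Ck_weight|exact: Ck_weight].
- by move=> p; rewrite mulr_gt0 ?weight_gt0.
- by move=> m n i p; exact: spin_vector_gram.
- move=> i p dp; have [U [s [sU Up]]] := local_section p.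
  by move=> k; apply: (spin_vector_commute sU dp Up).
Qed.

End SpinorFrame.

Theorem corollary4p32 (R : realType) (M : topologicalType)
  (S : oriented_surface R M) (g : lorentz_metric S) (Q : spin_structure g)
  (psip psim : Q -> 'cV[R[i]]_2) :
  time_orientable g ->
  section_Splus psip -> twistor psip -> nowhere_zero psip ->
  section_Sminus psim -> twistor psim -> nowhere_zero psim ->
  conformally_flat g /\
  (compact [set: M] -> geodesically_complete g).
Proof.
move=> [T [Ts Tt]] p1 p2 p3 m1 m2 m3.
have H := spinor_null_frame Ts Tt p1 p2 p3 m1 m2 m3.
split; first exact: null_frame_conformally_flat H.
exact: null_frame_complete H.
Qed.
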